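(* Let $\mu\in\mathcal{M}_{\mathcal{T}}$ be ergodic and set $c:=\int_{\mathbb{S}_d}\int_{[0,1]^d}h(x)\,dx\,d\mu(h)$. Then \[\mu\left(\left\{f\in\mathbb{S}_d\colon \lim_{t\to\infty}\mathcal{Z}_tf=c\cdot\mathbf{1}\right\}\right)=1,\] where the limit is taken in the weak-* topology of $\mathbb{S}_d$ as the real parameter $t\to\infty$.
   Context: $\mathbb{S}_d$ denotes the set of all $f\in L^\infty(\mathbb{R}^d)$ with $0\le f\le1$ almost everywhere, with the weak-* topology inherited from $L^\infty(\mathbb{R}^d)\simeq L^1(\mathbb{R}^d)^*$; $\mathbf{1}$ is the constant function $1$. For $v\in\mathbb{R}^d$, $\mathcal{T}_v\colon\mathbb{S}_d\to\mathbb{S}_d$ is $(\mathcal{T}_vf)(x)=f(x+v)$; for $t>0$, $\mathcal{Z}_t\colon\mathbb{S}_d\to\mathbb{S}_d$ is $(\mathcal{Z}_tf)(x)=f(tx)$. $\mathcal{M}_{\mathcal{T}}$ is the set of Borel probability measures on $\mathbb{S}_d$ invariant under every $\mathcal{T}_v$; such $\mu$ is ergodic if every Borel set $A$ with $\mathcal{T}_vA=A$ up to $\mu$-null sets for all $v\in\mathbb{R}^d$ has $\mu(A)\in\{0,1\}$. *)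

(* Defs.v *)
From HB Require Import structures.
From mathcomp Require Import all_boot all_order all_algebra.
From mathcomp Require Import all_classical all_reals all_analysis.
Set Implicit Arguments. Unset Strict Implicit. Unset Printing Implicit Defensive.
Import Order.TTheory GRing.Theory Num.Theory.
Import numFieldNormedType.Exports.
Local Open Scope classical_set_scope.
Local Open Scope ring_scope.

Section Sd.
Variables (R : realType) (d : nat).

(* R^d is modelled as d.-tuple R with its product (Borel) sigma-algebra. *)
Local Notation Rd := (d.-tuple R).

(* Lebesgue integral over R^n of an extended-real function, as the
   iterated one-dimensional Lebesgue integral (Fubini/Tonelli). *)
Fixpoint leb_int (n : nat) : (n.-tuple R -> \bar R) -> \bar R :=
  match n return (n.-tuple R -> \bar R) -> \bar R with
  | 0 => fun F => F [tuple]
  | n'.+1 => fun F =>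
      (\int[@lebesgue_measure R]_x leb_int (fun t => F (cons_tuple x t)))%E
  end.

Record L1fun := { l1f :> Rd -> R;
  l1f_meas : measurable_fun setT l1f;
  l1f_int : (leb_int (fun x => (`|l1f x|)%:E) < +oo)%E }.

Definition pairing (h : Rd -> R) : L1fun -> R :=
  fun g => fine (leb_int (fun x => (h x * g x)%:E)).

(* Elements of S_d: (Borel representatives of) functions with 0 <= f <= 1. *)
Record Sfun := { sd_fn :> Rd -> R;
  sfun_meas : measurable_fun setT sd_fn;
  sfun_01 : forall x, 0 <= sd_fn x <= 1 }.

HB.instance Definition _ := gen_eqMixin Sfun.
HB.instance Definition _ := gen_choiceMixin Sfun.

Lemma Sfun_zero_meas : measurable_fun [set: Rd] (fun _ : Rd => (0:R)).
Proof. exact: measurable_cst. Qed.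
Lemma Sfun_zero_01 : forall x : Rd, 0 <= (fun _ => (0:R)) x <= 1.
Proof. by move=> x; rewrite lexx ler01. Qed.
HB.instance Definition _ :=
  isPointed.Build Sfun (Build_Sfun Sfun_zero_meas Sfun_zero_01).

(* S_d with the weak-* topology: initial topology of the pairings with L^1. *)
Definition pairing_map (f : Sfun) : {ptws L1fun -> R} := pairing f.
Definition Sd_top : topologicalType := initial_topology pairing_map.

Definition Sd := g_sigma_algebraType (@open Sd_top).

Definition shift_pt (v x : Rd) : Rd := [tuple tnth x i + tnth v i | i < d].
Definition scale_pt (t : R) (x : Rd) : Rd := [tuple t * tnth x i | i < d].

Lemma measurable_shift_pt v : measurable_fun [set: Rd] (shift_pt v).
Proof.
apply/measurable_fun_tnthP => i /=.
rewrite /comp /shift_pt.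
under eq_fun do rewrite tnth_mktuple.
apply: measurable_realfun.measurable_funD => //; exact: measurable_tnth.
Qed.

Lemma measurable_scale_pt t : measurable_fun [set: Rd] (scale_pt t).
Proof.
apply/measurable_fun_tnthP => i /=.
rewrite /comp /scale_pt.
under eq_fun do rewrite tnth_mktuple.
apply: measurable_realfun.measurable_funM => //; exact: measurable_tnth.
Qed.

Definition Tv (v : Rd) (f : Sd) : Sd :=
  @Build_Sfun (fun x => f (shift_pt v x))
    (measurableT_comp (sfun_meas f) (measurable_shift_pt v))
    (fun x => sfun_01 f (shift_pt v x)).

Definition Zt (t : R) (f : Sd) : Sd :=
  @Build_Sfun (fun x => f (scale_pt t x))
    (measurableT_comp (sfun_meas f) (measurable_scale_pt t))
    (fun x => sfun_01 f (scale_pt t x)).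

Definition translation_invariant (mu : probability Sd R) :=
  forall (v : Rd) (A : set Sd), measurable A -> mu (Tv v @^-1` A) = mu A.

Definition ergodic (mu : probability Sd R) :=
  forall A : set Sd, measurable A ->
    (forall v : Rd, mu.-negligible ((Tv v @` A) `+` A)) ->
    mu A = 0%E \/ mu A = 1%E.

Definition unit_cube : set Rd := [set x | forall i, 0 <= tnth x i <= 1].
Definition cube_int (h : Rd -> R) : \bar R :=
  leb_int (fun x => (\1_unit_cube x * h x)%:E).

End Sd.

(* Main.v *)
(** Fix a vector q.  Writing 1_B for the indicator of the half-open box B with
    opposite corners 0 and q, the average of f over the dilated box n B is
    obtained from <f, 1_B> by taking a Birkhoff average of length n in each of
    the d coordinate directions in turn, for the translation by q_l e_l.  The
    one-dimensional maximal argument (Keane's stopping-time proof) gives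
    [int limsup A_n X_n <= int limsup X_n] for any sequence of functions
    0 <= X_n <= K, hence by induction on the direction
    [int limsup_n (avg over n B) <= int <f, 1_B>].
    The limsup can only decrease under translations along the quadrant of q, so
    by ergodicity it is at most int <f, 1_B> almost surely; applying this to
    1 - f as well, the averages converge to int <f, 1_B> = c |B|.

    For f in the countable intersection of these events over rational q, the
    passage to a real dilation factor is monotone (the boxes have a corner at
    the origin), and a lambda-system argument starting from rational boxes
    followed by density of simple functions reaches every g in L^1. *)

Require Import Defs.
From HB Require Import structures.
From mathcomp Require Import all_boot all_order all_algebra.
From mathcomp Require Import all_classical all_reals all_analysis.
From mathcomp Require Import measurable_realfun ring lra.
Import Order.TTheory GRing.Theory Num.Theory.
Import numFieldNormedType.Exports.
Set Implicit Arguments. Unset Strict Implicit. Unset Printing Implicit Defensive.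
Local Open Scope classical_set_scope.
Local Open Scope ring_scope.

(** * Upper limits of bounded real sequences *)

Section limsup.
Context {R : realType}.
Implicit Types (u v : R^nat) (a K : R).
Local Open Scope ereal_scope.

(** The obstacle is that ergodicity concerns the whole translation group: a single translation by
    q_l e_l need not be ergodic, and once one direction has been averaged, the function to be
    averaged next depends on n. A pointwise limit theorem therefore cannot be applied direction by
    direction with an identified limit. Only an inequality between integrals of upper limits is
    carried along; it survives a varying integrand because tail suprema provide a fixed one.
    Ergodicity enters when all directions are done, and only for sublevel sets of the final upper
    limit. These are stable in one sense, since a box anchored at 0 and moved into its own quadrant
    stays in a slightly larger anchored box; preservation of measure upgrades this to invariance up
    to null sets. Corners q of all signs occur because boxes away from 0 are rebuilt as signed
    combinations of anchored boxes in different quadrants. The reduction to countably many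
    conditions also settles measurability: the event of the theorem coincides with a countable
    intersection. *)

Lemma limn_esup_ub u a : (\forall n \near \oo, (u n <= a)%R) ->
  limn_esup (EFin \o u) <= a%:E.
Proof.
move=> [N _ uN]; rewrite limn_esup_lim; apply: lime_le; first exact: is_cvg_esups.
exists N => // n /= Nn; apply: ge_ereal_sup => _ [k /= nk <-].
by rewrite lee_fin; apply: uN => /=; exact: leq_trans nk.
Qed.

Lemma limn_esup_lt u a : limn_esup (EFin \o u) < a%:E ->
  \forall n \near \oo, (u n < a)%R.
Proof.
rewrite limn_esup_lim (cvg_lim _ (@cvg_esups_inf _ _))// => /ereal_inf_lt.
move=> [_ [N _ <-]] Na; exists N => // n /= Nn; rewrite -lte_fin.
by apply: le_lt_trans Na; apply: ereal_sup_ubound; exists n.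
Qed.

Lemma limn_esup_frequently u a m : a%:E < limn_esup (EFin \o u) ->
  exists2 n, (m <= n)%N & (a < u n)%R.
Proof.
move=> au; apply: contrapT => ex.
move: au; apply/negP; rewrite -leNgt; apply: limn_esup_ub.
exists m => // n /= mn; rewrite leNgt; apply/negP => aun.
by apply: ex; exists n.
Qed.

Lemma limn_esup_bounded u K : (forall n, (0 <= u n <= K)%R) ->
  0 <= limn_esup (EFin \o u) <= K%:E.
Proof.
move=> uK; apply/andP; split; last first.
  by apply: limn_esup_ub; apply: nearW => n; case/andP: (uK n).
rewrite leNgt; apply/negP => /limn_esup_lt[N _ uN].
have := uN N (leqnn N); rewrite ltNge => /negP; apply.
by case/andP: (uK N).
Qed.

Lemma limn_esup_bounded_fin u K : (forall n, (0 <= u n <= K)%R) ->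
  limn_esup (EFin \o u) \is a fin_num.
Proof.
move=> /limn_esup_bounded /andP[u0 uK].
by rewrite ge0_fin_numE// (le_lt_trans uK)// ltry.
Qed.

(** Transporting eventual upper bounds with a slack [e] is more flexible than a termwise comparison:
    [u n] may be compared with [v] at a shifted index, or up to a factor tending to 1. The bound [K]
    makes the upper limit of [v] finite, hence approachable from above. *)
Lemma limn_esup_le_of_ub u v K : (forall n, (0 <= v n <= K)%R) ->
  (forall a e, (0 < e)%R -> (\forall n \near \oo, (v n <= a)%R) ->
    \forall n \near \oo, (u n <= a + e)%R) ->
  limn_esup (EFin \o u) <= limn_esup (EFin \o v).
Proof.
move=> vK uv; have /fineK <- := limn_esup_bounded_fin vK.
set l := fine _; have lE : limn_esup (EFin \o v) = l%:E.
  by rewrite fineK// (limn_esup_bounded_fin vK).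
apply/lee_addgt0Pr => e e0; rewrite -EFinD; apply: limn_esup_ub.
have e20 : (0 < e / 2)%R by rewrite divr_gt0.
have -> : (l + e = (l + e / 2) + e / 2)%R by rewrite -addrA -splitr.
apply: uv => //.
have : limn_esup (EFin \o v) < (l + e / 2)%:E by rewrite lE lte_fin ltrDl.
by move=> /limn_esup_lt; apply: filterS => n /ltW.
Qed.

End limsup.

(** * The maximal inequality for Birkhoff averages *)

Definition birkhoff (T : Type) (R : realType) (S : T -> T) (n : nat)
  (f : T -> R) (x : T) : R := n%:R^-1 * \sum_(j < n) f (iter j S x).

Section averages.
Context d (T : measurableType d) (R : realType).
Variables (S : T -> T) (mS : measurable_fun setT S).

Lemma measurable_iter j : measurable_fun setT (iter j S).
Proof.
elim: j => [|j ih]; first exact: measurable_id.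
exact: (measurableT_comp mS ih).
Qed.

Lemma measurable_birkhoff n (f : T -> R) : measurable_fun setT f ->
  measurable_fun setT (birkhoff S n f).
Proof.
move=> mf; apply: measurable_funM => //.
apply: measurable_sum => j; apply: measurableT_comp => //.
exact: measurable_iter.
Qed.

Lemma birkhoff_bounded n (f : T -> R) K x : (forall x, 0 <= f x <= K) ->
  0 <= birkhoff S n f x <= K.
Proof.
move=> fK; have K0 : 0 <= K by case/andP: (fK x) => /le_trans; apply.
rewrite /birkhoff; apply/andP; split.
  rewrite mulr_ge0// sumr_ge0// => j _; by case/andP: (fK (iter j S x)).
(* The average of length 0 is 0, since [0^-1 = 0], so the bound holds for every [n]. *)
case: n => [|n]; first by rewrite invr0 mul0r.
rewrite mulrC ler_pdivrMr ?ltr0n//.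
rewrite (le_trans (ler_sum _ (fun (j : 'I_n.+1) _ => proj2 (andP (fK (iter j S x))))))//.
by rewrite sumr_const card_ord mulr_natr.
Qed.

Lemma le_birkhoff n (f g : T -> R) x : (forall x, f x <= g x) ->
  birkhoff S n f x <= birkhoff S n g x.
Proof. by move=> fg; apply: ler_wpM2l => //; apply: ler_sum. Qed.

End averages.

Section maximal.
Context d (T : measurableType d) (R : realType) (P : probability T R).
Variables (S : T -> T) (mS : measurable_fun setT S).
Hypothesis PS : forall A, measurable A -> P (S @^-1` A) = P A.

Lemma ge0_integral_invariant (f : T -> \bar R) :
  measurable_fun setT f -> (forall x, 0 <= f x)%E ->
  (\int[P]_x f (S x) = \int[P]_x f x)%E.
Proof.
move=> mf f0; rewrite -[LHS](@ge0_integral_pushforward _ _ _ _ _ S mS P setT f)//.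
by apply: eq_measure_integral => A mA _; exact: PS.
Qed.

Lemma ge0_integral_iter (f : T -> \bar R) j :
  measurable_fun setT f -> (forall x, 0 <= f x)%E ->
  (\int[P]_x f (iter j S x) = \int[P]_x f x)%E.
Proof.
move=> mf f0; elim: j => [//|j <-]; under eq_integral do rewrite iterSr.
apply: (@ge0_integral_invariant (fun x => f (iter j S x))) => //.
by apply: measurableT_comp => //; exact: measurable_iter.
Qed.

Variables (f : T -> R) (K : R) (K0 : 0 <= K).
Hypotheses (mf : measurable_fun setT f) (fK : forall x, 0 <= f x <= K).

Let Y x := limn_esup (fun n => (birkhoff S n f x)%:E).
Let y x := fine (Y x).

Let YK x : (0 <= Y x <= K%:E)%E.
Proof. by apply: limn_esup_bounded => n; apply: birkhoff_bounded. Qed.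

Let Yfin x : Y x \is a fin_num.
Proof.
apply: (@limn_esup_bounded_fin _ (fun n => birkhoff S n f x) K) => n.
exact: birkhoff_bounded.
Qed.

Let yE x : Y x = (y x)%:E. Proof. by rewrite fineK. Qed.

Let yK x : 0 <= y x <= K.
Proof. by have := YK x; rewrite yE !lee_fin. Qed.

Let mY : measurable_fun setT Y.
Proof.
apply: measurable_fun_limn_esup => n; apply/measurable_EFinP.
exact: measurable_birkhoff.
Qed.

Let my : measurable_fun setT y.
Proof. by apply: measurableT_comp => //. Qed.

Let cvg_Kn : (fun n => 2 * K * n%:R^-1) @ \oo --> (0 : R).
Proof.
rewrite -[0 in X in _ --> X](mulr0 (2 * K)); apply: cvgMr.
by apply/gtr0_cvgV0; [near=> n; rewrite ltr0n; near: n; exact: nbhs_infty_gt|exact: cvgr_idn].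
Unshelve. all: by end_near. Qed.

(** The sums along [x] and [S x] telescope to the two end terms, so the averages differ by at most
    [2 * K / n]. *)
Let y_invariant x : y (S x) = y x.
Proof.
have small e : 0 < e -> \forall n \near \oo,
    (0 < n)%N /\ 2 * K * n%:R^-1 <= e.
  move=> e0; near=> n; split; first by near: n; exact: nbhs_infty_gt.
  by near: n; have /cvgr_le := cvg_Kn; apply.
have shift n : (0 < n)%N ->
    `|birkhoff S n f (S x) - birkhoff S n f x| <= 2 * K * n%:R^-1.
  move=> n0; rewrite /birkhoff -mulrBr normrM ger0_norm ?invr_ge0// mulrC.
  rewrite ler_wpM2r ?invr_ge0//.
  under eq_bigr do rewrite -iterSr.
  have -> : \sum_(j < n) f (iter j.+1 S x) - \sum_(j < n) f (iter j S x) =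
     f (iter n S x) - f x.
    have := erefl (\sum_(j < n.+1) f (iter j S x)).
    rewrite {1}big_ord_recl big_ord_recr/= => h; apply/eqP.
    by rewrite subr_eq addrAC eq_sym subr_eq addrC -h addrC.
  have /andP[? ?] := fK (iter n S x); have /andP[? ?] := fK x.
  by rewrite ler_norml; apply/andP; split; lra.
congr fine; apply/eqP; rewrite eq_le; apply/andP; split;
  apply: (@limn_esup_le_of_ub _ _ _ K) => [n|a e e0 va];
  try exact: birkhoff_bounded; near=> n.
all: have [n0 ne] : (0 < n)%N /\ 2 * K * n%:R^-1 <= e by near: n; exact: small.
all: have /ler_normlP[s1 s2] := le_trans (shift n n0) ne.
- have : birkhoff S n f x <= a by near: n; exact: va.
  lra.
- have : birkhoff S n f (S x) <= a by near: n; exact: va.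
  lra.
Unshelve. all: by end_near. Qed.

Let y_iter j x : y (iter j S x) = y x.
Proof. by elim: j => //= j ih; rewrite y_invariant. Qed.

Section eps.
Variables (e : R) (e0 : 0 < e).

Let D N := [set x | forall n, (0 < n <= N)%N ->
  \sum_(j < n) f (iter j S x) < n%:R * (y x - e)].

Let mD N : measurable (D N).
Proof.
rewrite [D N](_ : _ = \bigcap_n (if (0 < n <= N)%N then
  [set x | \sum_(j < n) f (iter j S x) < n%:R * (y x - e)] else setT)); last first.
  apply/seteqP; split => x Dx n.
    by case: ifP => // nN _; exact: Dx.
  by move=> nN; have := Dx n I; rewrite nN.
apply: bigcapT_measurable => n; case: ifP => // _; rewrite -[X in measurable X]setTI.
under eq_set do rewrite -lte_fin.
apply: measurable_lte => //; apply/measurable_EFinP.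
  apply: measurable_sum => j; apply: measurableT_comp => //; exact: measurable_iter.
by apply: measurable_funM => //; exact: measurable_funB.
Qed.

Let g N x := f x + K * \1_(D N) x.

Let mg N : measurable_fun setT (g N).
Proof. by apply: measurable_funD => //; apply: measurable_funM. Qed.

Let g0 N x : 0 <= g N x.
Proof.
by apply: addr_ge0; [case/andP: (fK x)|rewrite mulr_ge0].
Qed.

(* Cut the orbit greedily: off D N use a stopping time at most N at which the
   average exceeds y - e, on D N make one step and pay with the K added to f. *)
Let greedy N M x : M%:R * (y x - e) <= \sum_(j < M) g N (iter j S x) + N%:R * K.
Proof.
have split_sum n m (h : T -> R) z : \sum_(j < n + m) h (iter j S z) =
    \sum_(j < n) h (iter j S z) + \sum_(j < m) h (iter j S (iter n S z)).
  rewrite big_split_ord/=; congr (_ + _); apply: eq_bigr => j _.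
  by rewrite -iterD addnC.
(* Invariance of [y] keeps the target [y z - e] constant along the orbit; this is what allows
   consecutive pieces of the orbit to be concatenated. *)
have step n m z : n%:R * (y z - e) <= \sum_(j < n) g N (iter j S z) ->
    m%:R * (y (iter n S z) - e) <=
      \sum_(j < m) g N (iter j S (iter n S z)) + N%:R * K ->
    (n + m)%:R * (y z - e) <= \sum_(j < n + m) g N (iter j S z) + N%:R * K.
  by move=> h1 h2; rewrite y_iter in h2; rewrite split_sum natrD mulrDl -addrA lerD.
elim/ltn_ind: M x => M ih x.
(* With at most [N] steps left, the stopping time may not fit any more. The boundary term [N * K]
   absorbs this remainder, as [y <= K]. *)
have [MN|NM] := leqP M N.
  apply: (@le_trans _ _ (N%:R * K)); last first.
    by rewrite lerDr; apply: sumr_ge0 => j _; exact: g0.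
  have /andP[y0 yk] := yK x.
  apply: (@le_trans _ _ (M%:R * K)); first by apply: ler_wpM2l => //; have := e0; lra.
  by rewrite ler_wpM2r ?K0// ler_nat.
have [Dx|/existsNP[n]] := pselect (D N x).
  have M0 : (0 < M)%N by exact: leq_ltn_trans NM.
  rewrite -[M in X in X <= _](subnKC M0) -[M in X in _ <= X](subnKC M0); apply: step.
    rewrite big_ord1 mul1r /= /g indicE mem_set// mulr1.
    by have /andP[? ?] := fK x; have /andP[? ?] := yK x; have := e0; lra.
  by apply: ih; rewrite subn1 prednK.
move=> /not_implyP[/andP[n0 nN]] /negP; rewrite -leNgt => hn.
have nM : (n <= M)%N by exact: leq_trans (ltnW NM).
rewrite -[M in X in X <= _](subnKC nM) -[M in X in _ <= X](subnKC nM); apply: step.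
  apply: le_trans hn _; apply: ler_sum => j _.
  by rewrite /g lerDl mulr_ge0 ?K0.
by apply: ih; rewrite ltn_subrL n0 (leq_trans n0 nM).
Qed.

(** By invariance of [P] all terms of the orbit sum have the same integral. The loss [M * e] stands
    on the right so that only nonnegative functions are integrated. After division by [M] the
    boundary term [N * K] becomes negligible. *)
Let integral_greedy N M : (M%:R%:E * \int[P]_x Y x <=
  M%:R%:E * \int[P]_x (g N x)%:E + (N%:R * K + M%:R * e)%:E)%E.
Proof.
have sum0 x : (0 <= (\sum_(j < M) g N (iter j S x))%:E)%E.
  by rewrite lee_fin; apply: sumr_ge0 => j _; exact: g0.
have mgj j : measurable_fun setT (fun x => (g N (iter j S x))%:E).
  by apply/measurable_EFinP; apply: measurableT_comp => //; exact: measurable_iter.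
have NK : 0 <= N%:R * K + M%:R * e.
  by rewrite addr_ge0// mulr_ge0// ltW.
rewrite -ge0_integralZl//; last by move=> x _; case/andP: (YK x).
have -> : (M%:R%:E * \int[P]_x (g N x)%:E =
    \int[P]_x (\sum_(j < M) g N (iter j S x))%:E)%E.
  under [RHS]eq_integral do rewrite -sumEFin.
  rewrite ge0_integral_sum//; last by move=> j x _; rewrite lee_fin.
  rewrite (eq_bigr (fun=> \int[P]_x (g N x)%:E)%E); last first.
    move=> j _; apply: (@ge0_integral_iter (fun x => (g N x)%:E)).
      exact/measurable_EFinP.
    by move=> x; rewrite lee_fin.
  elim: (M) => [|m ih]; first by rewrite big_ord0 mul0e.
  by rewrite big_ord_recr/= -ih -natr1 EFinD ge0_muleDl ?mul1e ?lee_fin.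
have -> : ((N%:R * K + M%:R * e)%:E = \int[P]_x (N%:R * K + M%:R * e)%:E)%E.
  by rewrite integral_cst//= probability_setT mule1.
rewrite -ge0_integralD//; last first.
  apply/measurable_EFinP; apply: measurable_sum => j.
  exact/measurable_EFinP/mgj.
apply: ge0_le_integral => //.
- by move=> x _; rewrite mule_ge0//; case/andP: (YK x).
- exact: measurable_funeM.
- apply: emeasurable_funD => //; apply/measurable_EFinP; apply: measurable_sum => j.
  exact/measurable_EFinP/mgj.
- move=> x _; rewrite yE -EFinM -EFinD lee_fin.
  by have := greedy N M x; rewrite mulrBr; lra.
Qed.

(** The upper limit exceeds [y x - e], so some average of positive length does too, and [x] leaves
    [D N] as soon as [N] reaches that length. *)
Let D_cvg : P \o D @ \oo --> 0%E.
Proof.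
have D0 : \bigcap_n D n = set0.
  rewrite -subset0 => x Dx.
  have yx : ((y x - e)%:E < limn_esup (EFin \o (fun n => birkhoff S n f x)))%E.
    by rewrite -/(Y x) yE lte_fin gtrBl.
  have [n n0 yn] := limn_esup_frequently 1%N yx.
  have := Dx n I n; rewrite n0 leqnn => /(_ isT).
  rewrite ltNge => /negP; apply.
  by rewrite mulrC -ler_pdivlMr ?ltr0n// mulrC ltW.
rewrite -[X in _ --> X](measure0 P) -D0; apply: nonincreasing_cvg_mu => //.
- by rewrite (le_lt_trans (probability_le1 _ _))// ltry.
- by rewrite D0.
- move=> m n mn; apply/subsetPset => x Dx k /andP[k0 km].
  by apply: Dx; rewrite k0 (leq_trans km).
Qed.

(** In the error, [K * e] pays for the set [D N] of measure at most [e], one [e] for the lowered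
    target [y - e], and the last [e] is spare room. *)
Lemma integral_limn_esup_birkhoff_eps :
  (\int[P]_x Y x <= \int[P]_x (f x)%:E + (e + (K + 1) * e)%:E)%E.
Proof.
have [N PDN] : exists N, (P (D N) <= e%:E)%E.
  apply: contrapT => /forallNP Pe.
  have : (e%:E <= 0)%E.
    apply: (cvge_ge _ D_cvg); apply: nearW => n.
    by have /negP := Pe n; rewrite -ltNge => /ltW.
  by rewrite lee_fin leNgt e0.
have gE : (\int[P]_x (g N x)%:E <= \int[P]_x (f x)%:E + (K * e)%:E)%E.
  under eq_integral do rewrite /g EFinD.
  rewrite ge0_integralD//.
  - rewrite leeD2l//; under eq_integral do rewrite EFinM.
    rewrite ge0_integralZl//; last by apply/measurable_EFinP.
    by rewrite integral_indic// setIT EFinM lee_wpmul2l.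
  - by move=> x _; rewrite lee_fin; case/andP: (fK x).
  - exact/measurable_EFinP.
  - by move=> x _; rewrite lee_fin mulr_ge0.
  - by apply/measurable_EFinP; apply: measurable_funM.
have bnd (h : T -> \bar R) : measurable_fun setT h ->
    (forall x, 0 <= h x <= K%:E)%E -> (\int[P]_x h x \is a fin_num)%E.
  move=> mh hK; rewrite ge0_fin_numE; last first.
    by apply: integral_ge0 => x _; case/andP: (hK x).
  apply: (@le_lt_trans _ _ (\int[P]_x K%:E)%E).
    by apply: ge0_le_integral => // x _; case/andP: (hK x).
  by rewrite integral_cst//= probability_setT mule1 ltry.
have fI : (\int[P]_x (f x)%:E \is a fin_num)%E.
  by apply: bnd => [|x]; [exact/measurable_EFinP|rewrite !lee_fin].
have YI : (\int[P]_x Y x \is a fin_num)%E by exact: bnd.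
have gI : (\int[P]_x (g N x)%:E \is a fin_num)%E.
  rewrite ge0_fin_numE; last by apply: integral_ge0 => x _; rewrite lee_fin.
  by apply: le_lt_trans gE _; rewrite lte_add_pinfty ?ltry// ltey_eq fI.
have := fun M => integral_greedy N M.
move: gE; rewrite -(fineK fI) -(fineK YI) -(fineK gI) -!EFinD !lee_fin.
set a := fine _; set b := fine _; set c := fine _ => gE h.
rewrite leNgt; apply/negP => alt.
(* [delta] is the excess per step if the claim fails; a horizon [M > N * K / delta] makes the total
   excess larger than the boundary term [N * K]. *)
pose delta := c - (b + K * e + e).
have d0 : 0 < delta by rewrite /delta; have := e0; lra.
have [M] : exists M : nat, N%:R * K / delta < M%:R.
  by exists (Num.bound (N%:R * K / delta)); rewrite archi_boundP//; apply: divr_ge0; [exact: mulr_ge0|exact: ltW].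
rewrite ltr_pdivrMr// => hM.
have := h M; rewrite -!EFinM -EFinD lee_fin => {}h.
have M0 : 0 <= M%:R :> R by [].
have : M%:R * delta <= N%:R * K.
  rewrite /delta.
  have : M%:R * a <= M%:R * (b + K * e) by rewrite ler_wpM2l.
  lra.
by move=> /(lt_le_trans hM); rewrite ltxx.
Qed.

End eps.

Lemma integral_limn_esup_birkhoff :
  (\int[P]_x limn_esup (fun n => (birkhoff S n f x)%:E) <= \int[P]_x (f x)%:E)%E.
Proof.
apply/lee_addgt0Pr => e e0.
(* The previous error is [(K + 2) * e'], so [e' = e / (K + 2)] is chosen. *)
have K20 : 0 < K + 2 by have := K0; lra.
have e'0 := divr_gt0 e0 K20.
apply: le_trans (integral_limn_esup_birkhoff_eps e'0) _.
rewrite leeD2l// lee_fin -[X in X + _]mul1r -mulrDl.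
rewrite le_eqVlt; apply/orP; left; apply/eqP; field.
exact: lt0r_neq0.
Qed.

End maximal.

(** * Birkhoff averages of a function that varies with the length *)

Section iterated.
Context d (T : measurableType d) (R : realType) (P : probability T R).
Variables (S : T -> T) (mS : measurable_fun setT S).
Hypothesis PS : forall A, measurable A -> P (S @^-1` A) = P A.
Variables (X : nat -> T -> R) (K : R) (K0 : 0 <= K).
Hypotheses (mX : forall n, measurable_fun setT (X n))
  (XK : forall n x, 0 <= X n x <= K).

Let W m x := fine (esups (fun n => (X n x)%:E) m).

Let esupsK m x : (0 <= esups (fun n => (X n x)%:E) m <= K%:E)%E.
Proof.
apply/andP; split.
  apply: (@le_trans _ _ (X m x)%:E); first by rewrite lee_fin; case/andP: (XK m x).
  by apply: ereal_sup_ubound; exists m => //=.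
by apply: ge_ereal_sup => _ [n _ <-]; rewrite lee_fin; case/andP: (XK n x).
Qed.

Let esupsE m x : esups (fun n => (X n x)%:E) m = (W m x)%:E.
Proof.
rewrite fineK//; have /andP[h1 h2] := esupsK m x.
by rewrite ge0_fin_numE// (le_lt_trans h2)// ltry.
Qed.

Let WK m x : 0 <= W m x <= K.
Proof. by have := esupsK m x; rewrite esupsE !lee_fin. Qed.

Let mW m : measurable_fun setT (W m).
Proof.
apply: measurableT_comp => //; apply: measurable_fun_esups => n.
exact/measurable_EFinP.
Qed.

Let X_W m n x : (m <= n)%N -> X n x <= W m x.
Proof.
move=> mn; rewrite -lee_fin -esupsE.
by apply: ereal_sup_ubound; exists n.
Qed.

(** For fixed [m], the tail supremum [W m] dominates [X n] for all [n >= m], so the averages of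
    [X n] are eventually below those of the fixed function [W m], to which the maximal inequality
    applies. Then [W m] decreases to the upper limit of the [X n], with dominating constant [K]. *)
Lemma integral_limn_esup_birkhoff_seq :
  (\int[P]_x limn_esup (fun n => (birkhoff S n (X n) x)%:E) <=
   \int[P]_x limn_esup (fun n => (X n x)%:E))%E.
Proof.
have step m : (\int[P]_x limn_esup (fun n => (birkhoff S n (X n) x)%:E) <=
    \int[P]_x (W m x)%:E)%E.
  apply: le_trans (integral_limn_esup_birkhoff mS PS K0 (mW m) (WK m)).
  apply: ge0_le_integral => //.
  - move=> x _; have /andP[] // := limn_esup_bounded (fun n =>
      birkhoff_bounded S n x (XK n)).
  - apply: measurable_fun_limn_esup => n; apply/measurable_EFinP.
    exact: measurable_birkhoff.
  - apply: measurable_fun_limn_esup => n; apply/measurable_EFinP.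
    exact: measurable_birkhoff.
  - move=> x _; apply: (limn_esup_le_of_ub (fun n => birkhoff_bounded S n x (WK m))).
    move=> a e e0; apply: filterS2 (nbhs_infty_ge m) => n mn Wa.
    apply: le_trans (le_trans Wa _); last by rewrite lerDl ltW.
    by apply: le_birkhoff => y; exact: X_W.
have cvgW : (\int[P]_x (W m x)%:E @[m --> \oo] -->
    \int[P]_x limn_esup (fun n => (X n x)%:E))%E.
  have [] := @dominated_convergence _ _ _ P setT measurableT
    (fun m x => (W m x)%:E) (fun x => limn_esup (fun n => (X n x)%:E)) (cst K%:E).
  - by move=> n; exact/measurable_EFinP.
  - by apply: measurable_fun_limn_esup => n; exact/measurable_EFinP.
  - apply: aeW => x _; under eq_fun do rewrite -esupsE.
    by rewrite limn_esup_lim; exact: is_cvg_esups.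
  - apply/integrableP; split; first exact: measurable_cst.
    rewrite (eq_integral (cst K%:E)); last by move=> x _; rewrite /= ger0_norm.
    by rewrite integral_cst//= probability_setT mule1 ltry.
  - by apply: aeW => x n _; rewrite /= lee_fin ger0_norm; case/andP: (WK n x).
  by move=> _ _.
by apply: (cvge_ge _ cvgW); apply: nearW => m; exact: step.
Qed.

End iterated.

(** * Lebesgue measure on tuples *)

(* Packs the image measure with a chosen proof of measurability, which
   unification cannot guess. *)
Definition image_measure d d' (T1 : measurableType d) (T2 : measurableType d')
    (R : realFieldType) (m : {measure set T1 -> \bar R}) (f : T1 -> T2)
    (mf : measurable_fun setT f) : {measure set T2 -> \bar R} :=
  measure_function_pushforward__canonical__measure_function_Measure m mf.

Section lebesgue_line.
Context {R : realType}.
Local Notation mu := (@lebesgue_measure R).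

Lemma lebesgue_measure_shift (a : R) (A : set R) : measurable A ->
  pushforward mu (fun x : measurableTypeR R => x + a : measurableTypeR R) A = mu A.
Proof.
have ma : measurable_fun [set: measurableTypeR R]
   (fun x : measurableTypeR R => x + a : measurableTypeR R).
  by apply: measurable_funD => //; exact: measurable_cst.
move=> mA; apply/esym/(@lebesgue_measure_unique _ (pushforward mu _)) => //= _ [[b c]] _ <-.
rewrite /pushforward (_ : _ @^-1` _ = `]b - a, c - a]%classic); last first.
  by apply/seteqP; split => x /=; rewrite !in_itv/= ltrBlDr lerBrDr.
by rewrite !lebesgue_measure_itv/= !lte_fin ltrD2r; case: ifP => // _; rewrite -!EFinB; congr EFin; ring.
Qed.

(** The factor [t] sits next to the image measure so that the left side is again a measure, and
    uniqueness can be checked on half-open intervals. *)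
Lemma lebesgue_measure_scale (t : R) (A : set R) : 0 < t -> measurable A ->
  (t%:E * pushforward mu (fun x : measurableTypeR R => (t * x)%R : measurableTypeR R) A = mu A)%E.
Proof.
move=> t0 mA.
have mt : measurable_fun [set: measurableTypeR R]
   (fun x : measurableTypeR R => (t * x)%R : measurableTypeR R).
  by apply: measurable_funM => //; exact: measurable_cst.
pose nu : {measure set (measurableTypeR R) -> \bar R} :=
  mscale (NngNum (ltW t0)) (image_measure mu mt).
apply/esym/(@lebesgue_measure_unique _ nu) => //= _ [[b c]] _ <-.
rewrite /nu/= /mscale/= /pushforward (_ : _ @^-1` _ = `]b / t, c / t]%classic); last first.
  by apply/seteqP; split => x /=; rewrite !in_itv/= ltr_pdivrMr// ler_pdivlMr// mulrC.
rewrite !lebesgue_measure_itv/= !lte_fin ltr_pM2r ?invr_gt0//; case: ifP => // _.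
  by rewrite -!EFinB -EFinM mulrBr !(mulrC t) !divfK// gt_eqF.
by rewrite mule0.
Qed.

Lemma ge0_integral_shift (a : R) (F : R -> \bar R) :
  measurable_fun [set: R] F -> (forall x, 0 <= F x)%E ->
  (\int[mu]_x F (x + a)%R = \int[mu]_x F x)%E.
Proof.
move=> mF F0.
have ma : measurable_fun [set: measurableTypeR R]
   (fun x : measurableTypeR R => x + a : measurableTypeR R).
  by apply: measurable_funD => //; exact: measurable_cst.
rewrite -[LHS](@ge0_integral_pushforward _ _ _ _ _ _ ma mu setT F)//.
by apply: eq_measure_integral => A mA _; exact: lebesgue_measure_shift.
Qed.

Lemma ge0_integral_scale (t : R) (F : R -> \bar R) : 0 < t ->
  measurable_fun [set: R] F -> (forall x, 0 <= F x)%E ->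
  (t%:E * \int[mu]_x F (t * x)%R = \int[mu]_x F x)%E.
Proof.
move=> t0 mF F0.
have mt : measurable_fun [set: measurableTypeR R]
   (fun x : measurableTypeR R => (t * x)%R : measurableTypeR R).
  by apply: measurable_funM => //; exact: measurable_cst.
rewrite -(@ge0_integral_pushforward _ _ _ _ _ _ mt mu setT F)//.
rewrite -(@ge0_integral_mscale _ _ _ _ setT measurableT (NngNum (ltW t0)))//.
by apply: eq_measure_integral => A mA _; exact: lebesgue_measure_scale.
Qed.

End lebesgue_line.

(** * The iterated integral as an integral against a product measure *)

Section leb_int_measure.
Context {R : realType}.
Local Notation mu := (@lebesgue_measure R).

Definition consp n (p : R * n.-tuple R) : n.+1.-tuple R := cons_tuple p.1 p.2.

Lemma measurable_consp n : measurable_fun [set: R * n.-tuple R] (@consp n).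
Proof. exact: (@measurable_cons _ _ _ _ fst n snd). Qed.

Definition unconsp n (t : n.+1.-tuple R) : R * n.-tuple R :=
  (thead t, [tuple of behead t]).

Lemma conspK n : cancel (@consp n) (@unconsp n).
Proof. by move=> [x t]; rewrite /unconsp/= theadE; congr pair; apply: val_inj. Qed.

Lemma measurable_unconsp n : measurable_fun [set: n.+1.-tuple R] (@unconsp n).
Proof.
by apply: measurable_fun_pair; [exact: measurable_tnth|exact: measurable_behead].
Qed.

Definition cons_measure n (m : {sigma_finite_measure set (n.-tuple R) -> \bar R}) :
  set (n.+1.-tuple R) -> \bar R := pushforward (mu \x m)%E (@consp n).

Section cons_measure.
Variables (n : nat) (m : {sigma_finite_measure set (n.-tuple R) -> \bar R}).

HB.instance Definition _ := Measure.copy (cons_measure m)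
  (image_measure (mu \x m)%E (@measurable_consp n)).

Lemma cons_measure_sigma_finite : sigma_finite setT (cons_measure m).
Proof.
have /sigma_finiteP[F [FT ndF Foo]] := sigma_finiteT mu.
have /sigma_finiteP[G [GT ndG Goo]] := sigma_finiteT m.
exists (fun k => @unconsp n @^-1` (F k `*` G k)) => [|k].
  apply/esym; rewrite -subTset => t _.
  have [i _ Fi] : (\bigcup_i F i) (unconsp t).1 by rewrite -FT.
  have [j _ Gj] : (\bigcup_i G i) (unconsp t).2 by rewrite -GT.
  exists (maxn i j) => //; split.
    by apply: (subsetPset _ _ (ndF i _ (leq_maxl i j))).
  by apply: (subsetPset _ _ (ndG j _ (leq_maxr i j))).
have [mF muF] := Foo k; have [mG muG] := Goo k.
split; first by rewrite -[X in measurable X]setTI; apply: measurable_unconsp => //; exact: measurableX.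
rewrite /cons_measure /pushforward -comp_preimage.
rewrite (_ : @unconsp n \o @consp n = id); last by apply/funext => p; exact: conspK.
by rewrite preimage_id product_measure1E// lte_mul_pinfty// ge0_fin_numE.
Qed.

HB.instance Definition _ := Measure_isSigmaFinite.Build _ _ _
  (cons_measure m) cons_measure_sigma_finite.

End cons_measure.

(** The recursion mirrors that of [leb_int], one coordinate at a time. Sigma-finiteness is carried
    in the type because the next level forms a product with this measure and applies Fubini to
    it. *)
Fixpoint leb_tuple n : {sigma_finite_measure set (n.-tuple R) -> \bar R} :=
  match n with
  | 0 => @dirac _ (0.-tuple R) [tuple] R
  | n'.+1 => cons_measure (leb_tuple n')
  end.

Local Open Scope ereal_scope.

Lemma leb_int_ge0 n (F : n.-tuple R -> \bar R) : (forall t, 0 <= F t) -> 0 <= leb_int F.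
Proof.
elim: n F => [|k ihk] G G0 /=; first exact: G0.
by apply: integral_ge0 => x _; exact: ihk.
Qed.

Lemma ge0_leb_intE n (F : n.-tuple R -> \bar R) : measurable_fun setT F ->
  (forall t, 0 <= F t) -> leb_int F = \int[leb_tuple n]_t F t.
Proof.
elim: n F => [|n ih] F mF F0 /=.
  by rewrite integral_dirac// diracT mul1e.
rewrite [in RHS]/cons_measure ge0_integral_pushforward//; last exact: measurable_consp.
rewrite preimage_setT fubini_tonelli1//=; last first.
  by apply: (measurableT_comp mF); exact: measurable_consp.
apply: eq_integral => x _; rewrite ih//.
by apply: (measurableT_comp mF); apply: measurable_cons => //; exact: measurable_cst.
Qed.

(** The parameter space is an arbitrary [T] so that the induction can absorb the next coordinate
    into it. No sign is assumed, so the outer integral is split into positive and negative parts,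
    each measurable by Tonelli. *)
Lemma measurable_leb_int d (T : measurableType d) n (F : T * n.-tuple R -> \bar R) :
  measurable_fun setT F ->
  measurable_fun setT (fun x => leb_int (fun t => F (x, t))).
Proof.
elim: n d T F => [|n ih] d T F mF /=.
  by apply: (measurableT_comp mF); exact: measurable_fun_pair.
have h : measurable_fun setT (fun q : T * R => leb_int (fun t => F (q.1, cons_tuple q.2 t))).
  apply: (ih _ (T * R)%type (fun p => F (p.1.1, cons_tuple p.1.2 p.2))) => //.
  apply: (measurableT_comp mF); apply: measurable_fun_pair.
    exact: (measurableT_comp measurable_fst measurable_fst).
  apply: measurable_cons; last exact: measurable_snd.
  exact: (measurableT_comp measurable_snd measurable_fst).
set H := (X in measurable_fun _ X) in h.
rewrite (_ : (fun x => _) = (fun x => \int[mu]_y H^\+ (x, y) - \int[mu]_y H^\- (x, y))).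
  apply: emeasurable_funB.
    by apply: (@measurable_fun_fubini_tonelli_F _ _ _ _ _ mu H^\+) => //; exact: measurable_funepos.
  by apply: (@measurable_fun_fubini_tonelli_F _ _ _ _ _ mu H^\-) => //; exact: measurable_funeneg.
apply/funext => x; rewrite integralE; congr (_ - _); apply: eq_integral => y _.
  by rewrite !funeposE.
by rewrite !funenegE.
Qed.

(** Integrability of [F] passes only to almost every section, so the induction hypothesis identifies
    the inner integrals almost everywhere; measurability of both inner integrals then gives equality
    of the outer ones. *)
Lemma leb_intE n (F : n.-tuple R -> \bar R) : (leb_tuple n).-integrable setT F ->
  leb_int F = \int[leb_tuple n]_t F t.
Proof.
elim: n F => [|n ih] F iF /=.
  by rewrite integral_dirac ?diracT ?mul1e//; exact: measurable_int iF.
have mF : measurable_fun setT F := measurable_int _ iF.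
have mcons : measurable_fun setT (F \o @consp n).
  by apply: (measurableT_comp mF); exact: measurable_consp.
have iFc : (mu \x leb_tuple n).-integrable setT (F \o @consp n).
  apply/integrableP; split => //.
  have /integrableP[_] := iF; rewrite /= [in X in X -> _]/cons_measure.
  rewrite ge0_integral_pushforward//; first exact: measurable_consp.
  exact: measurableT_comp.
rewrite [in RHS]/cons_measure integral_pushforward//; last exact: measurable_consp.
rewrite preimage_setT -integral12_prod_meas1//=.
have mL : measurable_fun setT (fun x => leb_int (fun t => F (cons_tuple x t))).
  exact: (measurable_leb_int (F := fun p => F (cons_tuple p.1 p.2)) mcons).
have mR := measurable_fubini_F iFc.
apply: ae_eq_integral; [exact: measurableT|exact: mL|exact: mR|].
have := ae_integrable1 iFc.
apply: filterS => x ix _; apply: ih; exact: ix.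
Qed.

End leb_int_measure.

(** * Translations and dilations under the integral on tuples *)

Section invariance.
Context {R : realType}.
Local Notation mu := (@lebesgue_measure R).

Lemma shift_pt_cons n (v : n.+1.-tuple R) x (t : n.-tuple R) :
  shift_pt v (cons_tuple x t) = cons_tuple (x + thead v) (shift_pt [tuple of behead v] t).
Proof.
apply: eq_from_tnth => i; rewrite tnth_mktuple.
case: (unliftP ord0 i) => [j ->|->].
  by rewrite !tnthS tnth_mktuple [in LHS](tuple_eta v) tnthS.
by rewrite !tnth0.
Qed.

Lemma scale_pt_cons n (s : R) x (t : n.-tuple R) :
  scale_pt s (cons_tuple x t) = cons_tuple (s * x) (scale_pt s t).
Proof.
apply: eq_from_tnth => i; rewrite tnth_mktuple.
case: (unliftP ord0 i) => [j ->|->].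
  by rewrite !tnthS tnth_mktuple.
by rewrite !tnth0.
Qed.

Local Open Scope ereal_scope.

Lemma ge0_leb_int_shift n (v : n.-tuple R) (F : n.-tuple R -> \bar R) :
  measurable_fun setT F -> (forall t, 0 <= F t) ->
  leb_int (F \o shift_pt v) = leb_int F.
Proof.
elim: n v F => [|n ih] v F mF F0 /=.
  by congr F; apply: eq_from_tnth => -[].
pose H x := leb_int (fun t => F (cons_tuple x t)).
have mFc : measurable_fun setT (fun p : R * n.-tuple R => F (cons_tuple p.1 p.2)).
  by apply: (measurableT_comp mF); exact: measurable_consp.
rewrite -(@ge0_integral_shift _ (thead v) H); last 2 first.
- exact: (measurable_leb_int mFc).
- by move=> x; exact: leb_int_ge0.
apply: eq_integral => x _; rewrite /H -(ih [tuple of behead v] (fun t => F (cons_tuple (x + thead v)%R t)))//.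
  by congr leb_int; apply/funext => t /=; rewrite shift_pt_cons.
by apply: (measurableT_comp mF); apply: measurable_cons => //; exact: measurable_cst.
Qed.

Lemma ge0_leb_int_scale n (s : R) (F : n.-tuple R -> \bar R) : (0 < s)%R ->
  measurable_fun setT F -> (forall t, 0 <= F t) ->
  (s ^+ n)%:E * leb_int (F \o scale_pt s) = leb_int F.
Proof.
move=> s0; elim: n F => [|n ih] F mF F0 /=.
  by rewrite mul1e; congr F; apply: eq_from_tnth => -[].
pose H x := leb_int (fun t => F (cons_tuple x t)).
have mFc : measurable_fun setT (fun p : R * n.-tuple R => F (cons_tuple p.1 p.2)).
  by apply: (measurableT_comp mF); exact: measurable_consp.
have mH : measurable_fun setT H by exact: (measurable_leb_int mFc).
have H0 x : 0 <= H x by exact: leb_int_ge0.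
rewrite -(@ge0_integral_scale _ s H)// exprS EFinM -muleA; congr (_ * _).
rewrite -ge0_integralZl_EFin//; last 3 first.
- by move=> x _; exact: leb_int_ge0.
- under eq_fun do under [X in leb_int X]eq_fun do rewrite scale_pt_cons.
  apply: (measurable_leb_int (F := fun p => F (cons_tuple (s * p.1)%R (scale_pt s p.2)))).
  apply: (measurableT_comp mF); apply: measurable_cons.
    by apply: measurable_funM; [exact: measurable_cst|exact: measurable_fst].
  by apply: (measurableT_comp (@measurable_scale_pt _ _ s)); exact: measurable_snd.
- by rewrite exprn_ge0// ltW.
apply: eq_integral => x _; rewrite /H -(ih (fun t => F (cons_tuple (s * x)%R t)))//.
  by congr (_ * leb_int _); apply/funext => t /=; rewrite scale_pt_cons.
by apply: (measurableT_comp mF); apply: measurable_cons => //; exact: measurable_cst.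
Qed.

Lemma leb_tuple_leb_int n (A : set (n.-tuple R)) : measurable A ->
  leb_tuple n A = leb_int (fun t => (\1_A t)%:E).
Proof.
move=> mA; rewrite ge0_leb_intE ?integral_indic ?setIT//.
exact/measurable_EFinP/measurable_indic.
Qed.

Lemma leb_tuple_shift n (v : n.-tuple R) (A : set (n.-tuple R)) : measurable A ->
  leb_tuple n (shift_pt v @^-1` A) = leb_tuple n A.
Proof.
move=> mA; have mvA : measurable (shift_pt v @^-1` A).
  by rewrite -[X in measurable X]setTI; exact: measurable_shift_pt.
rewrite !leb_tuple_leb_int// -[RHS](@ge0_leb_int_shift n v)//.
exact/measurable_EFinP/measurable_indic.
Qed.

Section integrable.
Variables (n : nat) (g : n.-tuple R -> R).
Hypothesis ig : (leb_tuple n).-integrable setT (EFin \o g).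

Let mg : measurable_fun setT (EFin \o g). Proof. exact: measurable_int ig. Qed.

Lemma integrable_shift (v : n.-tuple R) :
  (leb_tuple n).-integrable setT (EFin \o (g \o shift_pt v)).
Proof.
have mgs : measurable_fun setT (EFin \o (g \o shift_pt v)).
  by apply: (measurableT_comp mg); exact: measurable_shift_pt.
apply/integrableP; split => //.
have /integrableP[_] := ig; rewrite -!ge0_leb_intE//; try exact: measurableT_comp.
by rewrite -(@ge0_leb_int_shift n v)//; exact: measurableT_comp.
Qed.

Lemma integrable_scale (s : R) : (0 < s)%R ->
  (leb_tuple n).-integrable setT (EFin \o (g \o scale_pt s)).
Proof.
move=> s0; have mgs : measurable_fun setT (EFin \o (g \o scale_pt s)).
  by apply: (measurableT_comp mg); exact: measurable_scale_pt.
apply/integrableP; split => //.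
have /integrableP[_] := ig; rewrite -!ge0_leb_intE//; try exact: measurableT_comp.
rewrite -(@ge0_leb_int_scale n s)//; last exact: measurableT_comp.
case: (leb_int _) => [r _| |//]; first exact: ltry.
by rewrite gt0_muley ?lte_fin ?exprn_gt0.
Qed.

Lemma Rintegral_shift (v : n.-tuple R) :
  (\int[leb_tuple n]_x g (shift_pt v x) = \int[leb_tuple n]_x g x)%R.
Proof.
have ms := @measurable_shift_pt R n v.
rewrite /Rintegral; congr fine.
rewrite -[LHS](@integral_pushforward _ _ _ _ _ (@shift_pt R n v) ms (leb_tuple n) setT (EFin \o g))//.
  by apply: eq_measure_integral => A mA _; exact: leb_tuple_shift.
exact: integrable_shift.
Qed.

Lemma Rintegral_scale (s : R) : (0 < s)%R ->
  (s ^+ n * \int[leb_tuple n]_x g (scale_pt s x) = \int[leb_tuple n]_x g x)%R.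
Proof.
move=> s0; have igs := integrable_scale s0.
have mgs : measurable_fun setT (EFin \o (g \o scale_pt s)) := measurable_int _ igs.
rewrite /Rintegral -[X in (X * _)%R]/(fine (s ^+ n)%:E) -fineM//; last first.
  exact: integrable_fin_num.
congr fine; rewrite integralE [RHS]integralE muleBr//; last first.
  by apply: fin_num_adde_defr; exact: (integrable_pos_fin_num measurableT igs).
have part (G : n.-tuple R -> \bar R) : measurable_fun setT G -> (forall t, 0 <= G t) ->
    (s ^+ n)%:E * \int[leb_tuple n]_t G (scale_pt s t) = \int[leb_tuple n]_t G t.
  move=> mG G0; rewrite -!ge0_leb_intE//; first exact: ge0_leb_int_scale.
  by apply: (measurableT_comp mG); exact: measurable_scale_pt.
congr (_ - _).
  rewrite -[RHS]part//; last exact: measurable_funepos.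
  by congr (_ * _); apply: eq_integral => t _; rewrite !funeposE.
rewrite -[RHS]part//; last exact: measurable_funeneg.
by congr (_ * _); apply: eq_integral => t _; rewrite !funenegE.
Qed.

End integrable.
End invariance.

(** * The pairing as an integral *)

(* [pointwise_cvgP] without a topology on the index type. *)
Lemma ptws_cvgP (I T : Type) (V : topologicalType) (F : set_system T)
    (h : T -> {ptws I -> V}) (f : {ptws I -> V}) : Filter F ->
  (h @ F --> f) <-> (forall t, (fun x => h x t) @ F --> f t).
Proof.
move=> FF; split=> [Ff t U Ut|Ff].
  have /cvg_sup/(_ t) Ft := Ff.
  exact: (Ft _ (@initial_continuous {ptws I -> V} V (fun g => g t) f U Ut)).
apply/cvg_sup => t U [B [[W oW <-]] Wf] /filterS; apply.
by apply: Ff; exact: open_nbhs_nbhs.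
Qed.

Section pairing_integral.
Context {R : realType} {d : nat}.
Local Notation Rd := (d.-tuple R).
Local Notation lam := (@leb_tuple R d).
Local Notation L1 g := (lam.-integrable setT (EFin \o (g : Rd -> R))).
Implicit Types (h g : Rd -> R) (f : Sfun R d).

(** The pairing on bare functions: boxes, translates and linear combinations can be tested without
    packing them as [L1fun]. *)
Definition ip h g : R := \int[lam]_x (h x * g x).

Lemma L1fun_integrable (G : L1fun R d) : L1 G.
Proof.
apply/integrableP; split; first by apply/measurable_EFinP; exact: l1f_meas.
rewrite -ge0_leb_intE//; first exact: l1f_int.
by apply: measurableT_comp => //; apply/measurable_EFinP; exact: l1f_meas.
Qed.

Lemma integrable_L1fun g : L1 g -> exists G : L1fun R d, l1f G = g.
Proof.
move=> ig; have mg : measurable_fun setT g by apply/measurable_EFinP; exact: measurable_int ig.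
have gi : (leb_int (fun x => `|g x|%:E) < +oo)%E.
  have /integrableP[_] := ig; rewrite -ge0_leb_intE//.
  by apply: measurableT_comp => //; apply/measurable_EFinP.
by exists (Build_L1fun mg gi).
Qed.

Lemma integrable_mul_bounded h g K : measurable_fun setT h ->
  (forall x, `|h x| <= K) -> L1 g -> L1 (h \* g).
Proof.
move=> mh hK ig; have mg : measurable_fun setT g by apply/measurable_EFinP; exact: measurable_int ig.
have iKg : L1 (fun x => K * g x) by exact: (integrableZl measurableT K ig).
apply: le_integrable iKg => //.
  by apply/measurable_EFinP; exact: measurable_funM.
move=> x _ /=; rewrite lee_fin !normrM ler_wpM2r//.
by apply: (le_trans (hK x)); exact: ler_norm.
Qed.

Lemma pairing_ip h (G : L1fun R d) K : measurable_fun setT h ->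
  (forall x, `|h x| <= K) -> pairing h G = ip h G.
Proof.
move=> mh hK; rewrite /pairing /ip /Rintegral leb_intE//.
apply: (integrable_mul_bounded mh hK); exact: L1fun_integrable.
Qed.

Lemma sfun_norm_le1 f x : `|f x| <= 1.
Proof. by have /andP[f0 f1] := sfun_01 f x; rewrite ger0_norm. Qed.

Lemma integrable_sfun_mul f g : L1 g -> L1 (f \* g).
Proof.
by move=> ig; apply: (integrable_mul_bounded (sfun_meas f) (sfun_norm_le1 f)).
Qed.

Lemma pairing_sfun f (G : L1fun R d) : pairing f G = ip f G.
Proof. exact: (pairing_ip _ (sfun_meas f) (sfun_norm_le1 f)). Qed.

Lemma ip_addr f g1 g2 : L1 g1 -> L1 g2 ->
  ip f (fun x => g1 x + g2 x) = ip f g1 + ip f g2.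
Proof.
move=> i1 i2; rewrite /ip -RintegralD//; try exact: integrable_sfun_mul.
by apply: eq_Rintegral => x _; rewrite mulrDr.
Qed.

Lemma ip_subr f g1 g2 : L1 g1 -> L1 g2 ->
  ip f (fun x => g1 x - g2 x) = ip f g1 - ip f g2.
Proof.
move=> i1 i2; rewrite /ip -RintegralB//; try exact: integrable_sfun_mul.
by apply: eq_Rintegral => x _; rewrite mulrBr.
Qed.

Lemma ip_scaler f g r : L1 g -> ip f (fun x => r * g x) = r * ip f g.
Proof.
move=> ig; rewrite /ip -RintegralZl//; last exact: integrable_sfun_mul.
by apply: eq_Rintegral => x _; rewrite mulrCA.
Qed.

Lemma integrable_sumr I (s : seq I) (G : I -> Rd -> R) :
  (forall i, L1 (G i)) -> L1 (fun x => \sum_(i <- s) G i x).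
Proof.
move=> iG; rewrite (_ : EFin \o _ = (fun x => \sum_(i <- s) (EFin \o G i) x)%E).
  exact: integrable_sum.
by apply/funext => x /=; rewrite sumEFin.
Qed.

Lemma ip_sumr f I (s : seq I) (G : I -> Rd -> R) : (forall i, L1 (G i)) ->
  ip f (fun x => \sum_(i <- s) G i x) = \sum_(i <- s) ip f (G i).
Proof.
move=> iG; elim: s => [|i s ih].
  under [X in ip _ X]eq_fun do rewrite big_nil.
  by rewrite big_nil /ip; under eq_Rintegral do rewrite mulr0; rewrite Rintegral_cst// mul0r.
under [X in ip _ X]eq_fun do rewrite big_cons.
by rewrite big_cons ip_addr ?ih//; exact: integrable_sumr.
Qed.

Lemma ler_ip f g1 g2 : L1 g1 -> L1 g2 -> (forall x, g1 x <= g2 x) -> ip f g1 <= ip f g2.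
Proof.
move=> i1 i2 g12; apply: le_Rintegral => //; try exact: integrable_sfun_mul.
by move=> x _; rewrite ler_wpM2l//; case/andP: (sfun_01 f x).
Qed.

Lemma ip_bounded f g : L1 g -> (forall x, 0 <= g x) ->
  0 <= ip f g <= \int[lam]_x g x.
Proof.
move=> ig g0; apply/andP; split.
  by apply: Rintegral_ge0 => x _; rewrite mulr_ge0//; case/andP: (sfun_01 f x).
apply: le_Rintegral => //; first exact: integrable_sfun_mul.
by move=> x _; rewrite ler_piMl//; case/andP: (sfun_01 f x).
Qed.

Lemma ip_norm f g : L1 g -> `|ip f g| <= \int[lam]_x `|g x|.
Proof.
move=> ig; have ifg := integrable_sfun_mul f ig.
apply: le_trans (le_normr_Rintegral measurableT ifg) _.
apply: le_Rintegral => //.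
- exact: integrable_norm ifg.
- exact: integrable_norm ig.
by move=> x _; rewrite normrM ler_piMl// sfun_norm_le1.
Qed.

Definition opp_pt (v : Rd) : Rd := [tuple - tnth v i | i < d].

Lemma shift_ptK v : cancel (shift_pt v) (shift_pt (opp_pt v)).
Proof. by move=> x; apply: eq_from_tnth => i; rewrite !tnth_mktuple addrK. Qed.

Lemma shift_ptNK v : cancel (shift_pt (opp_pt v)) (shift_pt v).
Proof. by move=> x; apply: eq_from_tnth => i; rewrite !tnth_mktuple subrK. Qed.

Lemma ip_Tv v (f : Sd R d) g : L1 g -> ip (Tv v f) g = ip f (g \o shift_pt (opp_pt v)).
Proof.
move=> ig; have igv := integrable_shift ig (opp_pt v).
rewrite /ip -(@Rintegral_shift _ _ _ (integrable_sfun_mul f igv) v).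
by apply: eq_Rintegral => x _; rewrite /= shift_ptK.
Qed.

Lemma scale_ptK s : s != 0 -> cancel (@scale_pt R d s) (scale_pt s^-1).
Proof. by move=> s0 x; apply: eq_from_tnth => i; rewrite !tnth_mktuple mulKf. Qed.

Lemma ip_Zt (s : R) (f : Sd R d) g : 0 < s -> L1 g ->
  ip (Zt s f) g = s^-1 ^+ d * ip f (g \o scale_pt s^-1).
Proof.
move=> s0 ig; have si0 : 0 < s^-1 by rewrite invr_gt0.
have igs := integrable_scale ig si0.
rewrite /ip -(@Rintegral_scale _ _ _ (integrable_sfun_mul f igs) s)//.
rewrite mulrA -exprMn mulVf ?gt_eqF// expr1n mul1r.
by apply: eq_Rintegral => x _; rewrite /= scale_ptK// gt_eqF.
Qed.

Lemma Sfun_eq f1 f2 : sd_fn f1 = sd_fn f2 -> f1 = f2.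
Proof.
case: f1 f2 => [a m1 b1] [b m2 b2] /= ab; subst b.
by rewrite (Prop_irrelevance m1 m2) (Prop_irrelevance b1 b2).
Qed.

Lemma TvK v : cancel (Tv v) (@Tv R d (opp_pt v)).
Proof. by move=> f; apply: Sfun_eq; apply/funext => x /=; rewrite shift_ptNK. Qed.

Lemma TvNK v : cancel (Tv (opp_pt v)) (@Tv R d v).
Proof. by move=> f; apply: Sfun_eq; apply/funext => x /=; rewrite shift_ptK. Qed.

Lemma continuous_pairing (G : L1fun R d) :
  continuous ((fun f => pairing (sd_fn f) G) : Sd_top R d -> R).
Proof.
move=> f; have pf : {for f, continuous (@pairing_map R d : Sd_top R d -> _)}.
  exact: initial_continuous.
by have /(ptws_cvgP _ _ (nbhs_filter f))/(_ G) := pf.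
Qed.

Lemma measurable_ip g : L1 g -> measurable_fun setT (fun f : Sd R d => ip f g).
Proof.
move=> /integrable_L1fun[G <-].
apply: (measurability _ (RGenOpens.measurableE R)) => _ [_ [a [b ->]] <-].
rewrite setTI; apply: sub_sigma_algebra.
rewrite (_ : _ @^-1` _ = (fun f : Sd_top R d => pairing (sd_fn f) G) @^-1` `]a, b[%classic).
  by move/continuousP : (@continuous_pairing G); apply; exact: interval_open.
by apply/seteqP; split => f /=; rewrite pairing_sfun.
Qed.

(** Translation moves to the test function, which stays integrable; each pairing of [Tv v h] is
    therefore a pairing of [h] with another [L1fun]. *)
Lemma continuous_Tv v : continuous (@Tv R d v : Sd_top R d -> Sd_top R d).
Proof.
apply: continuous_comp_initial => f.
apply/(ptws_cvgP _ _ (nbhs_filter f)) => G.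
have [G' G'E] := integrable_L1fun (integrable_shift (L1fun_integrable G) (opp_pt v)).
have TG (h : Sd_top R d) : pairing_map (@Tv R d v h) G = pairing (sd_fn h) G'.
  by rewrite /pairing_map !pairing_sfun ip_Tv ?G'E//; exact: L1fun_integrable.
suff : continuous_at f (fun h : Sd_top R d => pairing (sd_fn (@Tv R d v h)) G) by [].
rewrite (_ : (fun h : Sd_top R d => _) = (fun h : Sd_top R d => pairing (sd_fn h) G')).
  exact: continuous_pairing.
by apply/funext => h; exact: TG.
Qed.

Lemma measurable_Tv v : measurable_fun setT (@Tv R d v).
Proof.
apply: (@measurability _ _ _ (Sd R d) _ _ (@open (Sd_top R d))) => // _ [U oU <-].
rewrite setTI.
by apply: sub_sigma_algebra; move/continuousP : (@continuous_Tv v); apply.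
Qed.

End pairing_integral.

(** * Boxes *)

Section windows.
Context {R : realType}.
Local Notation mu := (@lebesgue_measure R).

(* The segment from 0 to q, half-open so that translates by multiples of q tile. *)
Definition win (q x : R) : R := (if 0 <= q then 0 <= x < q else q <= x < 0)%:R.

Lemma win_indic q : win q = \1_[set` (if 0 <= q then `[0, q[ else `[q, 0[)].
Proof.
apply/funext => x; rewrite indicE /win; case: ifP => q0.
  by rewrite (_ : (x \in _) = (x \in `[0, q[)) ?in_itv//=; apply/idP/idP; rewrite inE.
by rewrite (_ : (x \in _) = (x \in `[q, 0[)) ?in_itv//=; apply/idP/idP; rewrite inE.
Qed.

Lemma measurable_win q : measurable_fun [set: R] (win q).
Proof. by rewrite win_indic; apply: measurable_indic; exact: measurable_itv. Qed.

Lemma win_ge0 q x : 0 <= win q x. Proof. by rewrite /win. Qed.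

Lemma integral_win q : (\int[mu]_x (win q x)%:E = `|q|%:E)%E.
Proof.
under eq_integral do rewrite win_indic.
rewrite integral_indic//= setIT; case: ifPn => q0.
  rewrite lebesgue_measure_itv/= lte_fin sube0 ger0_norm//.
  by move: q0; rewrite le_eqVlt => /predU1P[<-|->//]; rewrite ltxx.
by rewrite -ltNge in q0; rewrite lebesgue_measure_itv/= lte_fin q0 add0e ltr0_norm.
Qed.

Lemma win_pos (s q x : R) : 0 <= s -> 0 <= q -> win (s * q) x = (0 <= x < s * q)%R%:R.
Proof. by move=> s0 q0; rewrite /win mulr_ge0. Qed.

Lemma win_neg (s q x : R) : 0 <= s -> q < 0 -> win (s * q) x = (s * q <= x < 0)%R%:R.
Proof.
move=> s0 q0; rewrite /win; case: ifPn => // sq0.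
(* Only [s = 0] reaches this branch; both descriptions then give the empty segment. *)
have -> : s * q = 0 by apply/eqP; rewrite eq_le sq0 andbT mulr_ge0_le0// ltW.
by [].
Qed.

Lemma winS (n : nat) (q x : R) :
  win (n.+1%:R * q) x = win (n%:R * q) x + win q (x - n%:R * q).
Proof.
have [q0|q0] := leP 0 q.
  rewrite -[q in win q (x - _)]mul1r !win_pos// mul1r -natr1 mulrDl mul1r.
  have m0 : 0 <= n%:R * q by rewrite mulr_ge0.
  rewrite subr_ge0 ltrBlDl; case: (ltP x (n%:R * q)) => xm /=.
    by rewrite addr0 andbT (lt_le_trans xm) ?lerDl// andbT.
  by rewrite (le_trans m0 xm)/= add0r.
rewrite -[q in win q (x - _)]mul1r !win_neg// mul1r -natr1 mulrDl mul1r.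
have m0 : n%:R * q <= 0 by rewrite mulr_ge0_le0// ltW.
rewrite subr_lt0 lerBrDl; case: (ltP x (n%:R * q)) => xm /=.
  by rewrite (lt_le_trans xm m0) add0r.
by rewrite andbF addr0 (le_trans _ xm)// gerDl ltW.
Qed.

Lemma win_sum (n : nat) q x :
  win (n%:R * q) x = \sum_(j < n) win q (x - j%:R * q).
Proof.
elim: n => [|n ih]; last by rewrite big_ord_recr/= winS ih.
rewrite big_ord0 mul0r /win lexx.
by case: (leP 0 x) => //= x0; rewrite ltNge x0.
Qed.

Lemma win_scale (s q x : R) : 0 < s -> win (s * q) x = win q (s^-1 * x).
Proof.
move=> s0; rewrite /win pmulr_rge0// pmulr_rge0 ?invr_gt0// pmulr_rlt0 ?invr_gt0//.
by rewrite ltr_pdivrMl// ler_pdivlMl.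
Qed.

Lemma win_le (s t q x : R) : 0 <= s <= t -> win (s * q) x <= win (t * q) x.
Proof.
move=> /andP[s0 st]; have t0 := le_trans s0 st.
have [q0|q0] := leP 0 q.
  have sq : s * q <= t * q by rewrite ler_wpM2r.
  rewrite !win_pos// ler_nat; case: (leP 0 x) => //= x0.
  by case: (ltP x (s * q)) => // /lt_le_trans ->.
have sq : t * q <= s * q by rewrite ler_wnM2r// ltW.
rewrite !win_neg// ler_nat; case: (leP (s * q) x) => //= sx.
by rewrite (le_trans sq sx).
Qed.

(** Moving a window in the direction of [q] stays inside a longer window anchored at 0, while moving
    it against [q] would cross 0. This is the source of the restriction to the quadrant of [q]. *)
Lemma win_shift_le (n m s q x : R) : 0 <= n -> 0 <= s <= m ->
  win (n * q) (x - s * q) <= win ((n + m) * q) x.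
Proof.
move=> n0 /andP[s0 sm]; have m0 := le_trans s0 sm; have nm0 := addr_ge0 n0 m0.
have [q0|q0] := leP 0 q.
  have sq : s * q <= m * q by rewrite ler_wpM2r.
  have sq0 : 0 <= s * q by rewrite mulr_ge0.
  rewrite !win_pos// ler_nat mulrDl; case: andP => [[h1 h2]|//].
  by rewrite lt0b; apply/andP; split; lra.
have sq : m * q <= s * q by rewrite ler_wnM2r// ltW.
have sq0 : s * q <= 0 by rewrite mulr_ge0_le0// ltW.
rewrite !win_neg// ler_nat mulrDl; case: andP => [[h1 h2]|//].
by rewrite lt0b; apply/andP; split; lra.
Qed.

End windows.

Section product_functions.
Context {R : realType}.
Local Notation mu := (@lebesgue_measure R).
Local Open Scope ereal_scope.

Definition pfun n (u : 'I_n -> R -> R) (x : n.-tuple R) : R :=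
  (\prod_(i < n) u i (tnth x i))%R.

Lemma pfun_cons n (u : 'I_n.+1 -> R -> R) x (t : n.-tuple R) :
  pfun u (cons_tuple x t) = (u ord0 x * pfun (fun i => u (lift ord0 i)) t)%R.
Proof.
rewrite /pfun big_ord_recl tnth0; congr (_ * _)%R.
by apply: eq_bigr => i _; rewrite tnthS.
Qed.

Lemma measurable_pfun n (u : 'I_n -> R -> R) :
  (forall i, measurable_fun setT (u i)) -> measurable_fun setT (pfun u).
Proof.
move=> mu'; apply: measurable_prod => i _.
by apply: (measurableT_comp (mu' i)); exact: measurable_tnth.
Qed.

Lemma leb_int_pfun n (u : 'I_n -> R -> R) : (forall i, measurable_fun setT (u i)) ->
  (forall i x, 0 <= u i x)%R ->
  leb_int (fun x => (pfun u x)%:E) = \prod_(i < n) \int[mu]_x (u i x)%:E.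
Proof.
elim: n u => [|n ih] u mu' u0 /=; first by rewrite /pfun !big_ord0.
rewrite big_ord_recl -ge0_integralZr//.
- apply: eq_integral => x _; rewrite -ih//.
  under [X in leb_int X]eq_fun do rewrite pfun_cons EFinM.
  rewrite !ge0_leb_intE//.
  + rewrite ge0_integralZl//.
    * by apply/measurable_EFinP; exact: measurable_pfun.
    * by move=> t _; rewrite lee_fin prodr_ge0.
    * by rewrite lee_fin.
  + by apply/measurable_EFinP; exact: measurable_pfun.
  + by move=> t; rewrite lee_fin prodr_ge0.
  + under eq_fun do rewrite -EFinM.
    apply/measurable_EFinP/measurable_funM; first exact: measurable_cst.
    exact: measurable_pfun.
  + by move=> t; rewrite -EFinM lee_fin mulr_ge0// prodr_ge0.
- by apply/measurable_EFinP; exact: mu'.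
- by move=> x _; rewrite lee_fin.
- by apply: prode_ge0 => i _; apply: integral_ge0 => x _; rewrite lee_fin.
Qed.

Lemma integrable_pfun n (u : 'I_n -> R -> R) : (forall i, measurable_fun setT (u i)) ->
  (forall i, \int[mu]_x `|u i x|%:E < +oo) ->
  (leb_tuple n).-integrable setT (EFin \o pfun u).
Proof.
move=> mu' ui; apply/integrableP; split.
  by apply/measurable_EFinP; exact: measurable_pfun.
rewrite (eq_integral (fun x => (pfun (fun i x => `|u i x|%R) x)%:E)); last first.
  by move=> x _; rewrite /= /pfun normr_prod.
have mn i : measurable_fun setT (fun x => `|u i x|%R) by exact: measurableT_comp.
rewrite -ge0_leb_intE ?leb_int_pfun//.
- rewrite -ge0_fin_numE; last first.
    by apply: prode_ge0 => i _; apply: integral_ge0 => x _; rewrite lee_fin.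
  apply: prode_fin_num => i _; rewrite ge0_fin_numE//.
  by apply: integral_ge0 => x _; rewrite lee_fin.
- by apply/measurable_EFinP; exact: measurable_pfun.
- by move=> t; rewrite lee_fin prodr_ge0.
Qed.

End product_functions.

Section boxes.
Context {R : realType} {d : nat}.
Local Notation Rd := (d.-tuple R).
Local Notation lam := (@leb_tuple R d).
Implicit Types q : 'I_d -> R.

Definition box q : Rd -> R := pfun (fun i => win (q i)).

Lemma box_ge0 q x : 0 <= box q x.
Proof. by apply: prodr_ge0 => i _; exact: win_ge0. Qed.

Lemma integrable_box q : lam.-integrable setT (EFin \o box q).
Proof.
apply: integrable_pfun => i; first exact: measurable_win.
under eq_integral do rewrite ger0_norm ?win_ge0//.
by rewrite integral_win ltry.
Qed.

Lemma Rintegral_box q : \int[lam]_x box q x = \prod_i `|q i|.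
Proof.
rewrite /Rintegral -ge0_leb_intE; last 2 first.
- exact: measurable_int (integrable_box q).
- by move=> x; rewrite lee_fin box_ge0.
rewrite leb_int_pfun; last 2 first.
- by move=> i; exact: measurable_win.
- by move=> i x; exact: win_ge0.
rewrite (eq_bigr (fun i => `|q i|%:E)) ?prodEFin// => i _.
exact: integral_win.
Qed.

Definition axis (l : 'I_d) (r : R) : Rd := [tuple if i == l then r else 0 | i < d].

Lemma iter_Tv_axis l r j (f : Sd R d) :
  iter j (Tv (axis l r)) f = Tv (axis l (j%:R * r)) f.
Proof.
elim: j => [|j ih] /=.
  apply: Sfun_eq; apply/funext => x /=; congr (sd_fn f _).
  apply: eq_from_tnth => i; rewrite !tnth_mktuple mul0r.
  by case: ifP; rewrite addr0.
rewrite ih; apply: Sfun_eq; apply/funext => x /=; congr (sd_fn f _).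
apply: eq_from_tnth => i; rewrite !tnth_mktuple.
by case: ifP => _; rewrite ?addr0// -natr1 mulrDl mul1r -addrA [_ + r]addrC.
Qed.

Lemma box_sum l (n : nat) q q' x : (forall i, i != l -> q' i = q i) ->
  q' l = n%:R * q l ->
  box q' x = \sum_(j < n) box q (shift_pt (opp_pt (axis l (j%:R * q l))) x).
Proof.
move=> qq' ql; rewrite /box /pfun (bigD1 l)//= ql win_sum mulr_suml.
apply: eq_bigr => j _; rewrite [RHS](bigD1 l)//= !tnth_mktuple eqxx; congr (_ * _).
by apply: eq_bigr => i il; rewrite qq'// !tnth_mktuple (negbTE il) oppr0 addr0.
Qed.

(** The dilated box is tiled along axis [l], and the translations of the tiles are moved onto [f]:
    dilation in one direction becomes an orbit sum. *)
Lemma ip_box_sum (f : Sd R d) l (n : nat) q q' : (forall i, i != l -> q' i = q i) ->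
  q' l = n%:R * q l ->
  ip f (box q') = \sum_(j < n) ip (iter j (Tv (axis l (q l))) f) (box q).
Proof.
move=> qq' ql; under eq_bigr do rewrite iter_Tv_axis ip_Tv ?integrable_box//.
rewrite -(@ip_sumr _ _ f _ _
  (fun j : 'I_n => box q \o shift_pt (opp_pt (axis l (j%:R * q l))))); last first.
  by move=> j; apply: integrable_shift; exact: integrable_box.
by congr ip; apply/funext => x; rewrite (box_sum _ qq' ql).
Qed.

Lemma box_scale s q x : 0 < s -> box (fun i => s * q i) x = box q (scale_pt s^-1 x).
Proof.
by move=> s0; apply: eq_bigr => i _; rewrite win_scale// tnth_mktuple.
Qed.

Lemma ip_Zt_box s (f : Sd R d) q : 0 < s ->
  ip (Zt s f) (box q) = s^-1 ^+ d * ip f (box (fun i => s * q i)).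
Proof.
move=> s0; rewrite ip_Zt ?integrable_box//; congr (_ * ip _ _).
by apply/funext => x; rewrite box_scale.
Qed.

End boxes.

(** * Almost sure bound for box averages *)

Lemma probability1_ae d (T : measurableType d) (R : realType) (P : probability T R)
    (A : set T) : measurable A -> P A = 1%E <-> {ae P, forall x, A x}.
Proof.
move=> mA; have mAC : measurable (~` A) by exact: measurableC.
split=> [PA|[N [mN N0 AN]]].
  by exists (~` A); split => //; rewrite [LHS]probability_setC// PA subee.
have AC0 : P (~` A) = 0%E.
  by apply/eqP; rewrite eq_le measure_ge0 andbT -N0 le_measure ?inE.
by rewrite -[A]setCK probability_setC// AC0 sube0.
Qed.

Lemma cvg_ratio_exp (R : realType) (d m : nat) : ((n + m)%:R / n%:R : R) ^+ d @[n --> \oo] --> (1 : R).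
Proof.
suff : ((n + m)%:R / n%:R : R) ^+ d @[n --> \oo] --> ((1 + m%:R * 0) ^+ d : R).
  by rewrite mulr0 addr0 expr1n.
apply: (@cvg_trans _ ((1 + m%:R * n%:R^-1 : R) ^+ d @[n --> \oo])).
  apply: near_eq_cvg; near=> n; congr (_ ^+ _); rewrite natrD mulrDl mulfV//.
  by rewrite pnatr_eq0 -lt0n; near: n; exact: nbhs_infty_gt.
apply: (@continuous_cvg _ _ _ _ _ (fun n => 1 + m%:R / n%:R : R) (fun x : R => x ^+ d));
  first exact: exprn_continuous.
apply: cvgD; first exact: cvg_cst.
apply: cvgMr; apply/gtr0_cvgV0; last exact: cvgr_idn.
by near=> n; rewrite ltr0n; near: n; exact: nbhs_infty_gt.
Unshelve. all: by end_near. Qed.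

Section box_averages.
Context {R : realType} {d : nat}.
Local Notation Rd := (d.-tuple R).
Local Notation Sd := (Sd R d).
Variables (mu : probability Sd R) (inv : translation_invariant mu) (erg : ergodic mu).
(** [h] stands for the identity and for the complement [1 - f], so that one argument yields both the
    upper and the lower bound. *)
Variables (q : 'I_d -> R) (h : Sd -> Sd).
Hypothesis q0 : forall i, q i != 0.
Hypothesis hT : forall v f, h (Tv v f) = Tv v (h f).
Hypothesis mh : forall g, (leb_tuple d).-integrable setT (EFin \o (g : Rd -> R)) ->
  measurable_fun setT (fun f => ip (h f) g).

Let K := \prod_i `|q i|.

(* Averages over the box of q dilated by n in the first l directions only. *)
Let X l n f := n%:R^-1 ^+ l *
  ip (h f) (box (fun i => if (i < l)%N then n%:R * q i else q i)).

Let XS (l : 'I_d) n : X l.+1 n = birkhoff (Tv (axis l (q l))) n (X l n).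
Proof.
apply/funext => f; rewrite /X /birkhoff.
rewrite (@ip_box_sum _ _ _ l n (fun i => if (i < l)%N then n%:R * q i else q i)).
- rewrite ltnn -mulr_sumr mulrA -exprS; congr (_ * _).
  apply: eq_bigr => j _; congr (ip (sd_fn _) _).
  by elim: (nat_of_ord j) => //= k ->; rewrite hT.
- by move=> i il; rewrite ltnS leq_eqVlt (negbTE (il : i != l :> nat)).
- by rewrite ltnSn ltnn.
Qed.

Let X0 n f : X 0 n f = ip (h f) (box q).
Proof. by rewrite /X expr0 mul1r. Qed.

Let mX l n : measurable_fun setT (X l n).
Proof.
apply: measurable_funM; first exact: measurable_cst.
by apply: mh; exact: integrable_box.
Qed.

(** Averaging preserves bounds, so the volume of the undilated box bounds all averages, uniformly in
    [n] and [l]. *)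
Let XK l n f : (l <= d)%N -> 0 <= X l n f <= K.
Proof.
elim: l n f => [|l ih] n f ld.
  by rewrite X0 /K -Rintegral_box; apply: ip_bounded; [exact: integrable_box|exact: box_ge0].
rewrite (XS (Ordinal ld)); apply: birkhoff_bounded => x; apply: ih; exact: ltnW.
Qed.

Let integral_limsup l : (l <= d)%N ->
  (\int[mu]_f limn_esup (fun n => (X l n f)%:E) <= \int[mu]_f (ip (h f) (box q))%:E)%E.
Proof.
have K0 : 0 <= K by apply: prodr_ge0.
elim: l => [|l ih] ld.
  rewrite le_eqVlt; apply/orP; left; apply/eqP; apply: eq_integral => f _.
  rewrite limn_esup_lim; apply/cvg_lim => //; apply: cvg_esups.
  by rewrite (_ : (fun n => _) = cst (ip (h f) (box q))%:E); [exact: cvg_cst|apply/funext => n; rewrite X0].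
have := @integral_limn_esup_birkhoff_seq _ _ _ mu _ (measurable_Tv (axis (Ordinal ld) (q (Ordinal ld))))
  (@inv _) (X l) K K0 (mX l) (fun n x => XK n x (ltnW ld)).
move=> /le_trans /(_ (ih (ltnW ld))); apply: le_trans.
rewrite le_eqVlt; apply/orP; left; apply/eqP; apply: eq_integral => f _.
by congr limn_esup; apply/funext => n; rewrite (XS (Ordinal ld)).
Qed.

Let Y f := limn_esup (fun n => (X d n f)%:E).

Let mY : measurable_fun setT Y.
Proof. by apply: measurable_fun_limn_esup => n; apply/measurable_EFinP; exact: mX. Qed.

Let YK f : (0 <= Y f <= K%:E)%E.
Proof. by apply: limn_esup_bounded => n; exact: XK. Qed.

Let XdE n f : X d n f = n%:R^-1 ^+ d * ip (h f) (box (fun i => n%:R * q i)).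
Proof. by rewrite /X; under eq_fun do rewrite ltn_ord. Qed.

Let u (s : 'I_d -> R) : Rd := [tuple s i * q i | i < d].

Let X_shift (s : 'I_d -> R) m n f : (forall i, 0 <= s i <= m%:R) -> (0 < n)%N ->
  X d n (Tv (u s) f) <= ((n + m)%:R / n%:R) ^+ d * X d (n + m) f.
Proof.
move=> sm n0; rewrite !XdE mulrA -exprMn mulrAC mulfV ?mul1r; last first.
  by rewrite pnatr_eq0 -lt0n addn_gt0 n0.
rewrite ler_wpM2l ?exprn_ge0// hT ip_Tv; last exact: integrable_box.
apply: ler_ip; [exact/integrable_shift/integrable_box|exact: integrable_box|].
move=> x; apply: ler_prod => i _; rewrite win_ge0/= !tnth_mktuple.
by rewrite natrD; apply: win_shift_le.
Qed.

(** The translated box of size [n] lies in the anchored box of size [n + m], and the volume ratio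
    [((n + m) / n) ^ d] tends to 1. *)
Let Y_shift (s : 'I_d -> R) m f : (forall i, 0 <= s i <= m%:R) ->
  (Y (Tv (u s) f) <= Y f)%E.
Proof.
move=> sm; apply: (@limn_esup_le_of_ub _ _ _ K) => [n|a e e0 Xa]; first exact: XK.
have ra : ((n + m)%:R / n%:R : R) ^+ d * a @[n --> \oo] --> a.
  by rewrite -[X in _ --> X]mul1r; apply: cvgMl; exact: cvg_ratio_exp.
near=> n.
have n0 : (0 < n)%N by near: n; exact: nbhs_infty_gt.
apply: (le_trans (X_shift f sm n0)).
apply: (@le_trans _ _ (((n + m)%:R / n%:R) ^+ d * a)).
  apply: ler_wpM2l; first by rewrite exprn_ge0// divr_ge0.
  near: n; case: Xa => N _ Xa; exists N => // n /= Nn.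
  by apply: Xa => /=; exact: leq_trans (leq_addr _ _).
by near: n; apply: (cvgr_le _ ra); rewrite ltrDl.
Unshelve. all: by end_near. Qed.

Let e := fine (\int[mu]_f (ip (h f) (box q))%:E)%E.

Let eE : (\int[mu]_f (ip (h f) (box q))%:E)%E = e%:E.
Proof.
rewrite fineK// ge0_fin_numE; last first.
  by apply: integral_ge0 => f _; rewrite lee_fin -(X0 0) ; case/andP: (XK 0 f (leq0n d)).
apply: (@le_lt_trans _ _ (\int[mu]_f K%:E)%E).
  apply: ge0_le_integral => //.
  - by move=> f _; rewrite lee_fin -(X0 0) ; case/andP: (XK 0 f (leq0n d)).
  - by apply/measurable_EFinP; apply: mh; exact: integrable_box.
  - by move=> f _; rewrite lee_fin -(X0 0) ; case/andP: (XK 0 f (leq0n d)).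
by rewrite integral_cst//= probability_setT mule1 ltry.
Qed.

Let preimage_measurable v (A : set Sd) : measurable A -> measurable (Tv v @^-1` A).
Proof. by move=> mA; rewrite -[X in measurable X]setTI; exact: measurable_Tv. Qed.

(* A set stable under the translations along the quadrant of q is invariant up
   to null sets under these, hence under all their differences. *)
Let quadrant_ergodic (A : set Sd) : measurable A ->
  (forall s, (forall i, 0 <= s i) -> forall f, A f -> A (Tv (u s) f)) ->
  mu A = 0%E \/ mu A = 1%E.
Proof.
move=> mA As; apply: erg => // v.
(* [A] is contained in its preimage, and both have the same finite measure. *)
have null s : (forall i, 0 <= s i) -> mu (Tv (u s) @^-1` A `\` A) = 0%E.
  move=> s0; rewrite measureD//; last 2 first.
  - exact: preimage_measurable.
  - by rewrite (le_lt_trans (probability_le1 _ (preimage_measurable _ mA)))// ltry.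
  rewrite (_ : _ `&` A = A); last by apply/setIidPr => f; exact: As.
  transitivity (mu A - mu A)%E; first by congr (_ - _)%E; exact: inv.
  by rewrite subee// fin_num_measure.
(* [a] is the vector opposite to [v] in units of [q]; its positive and negative parts [s1] and [s2]
   write that vector as [u s1] minus [u s2], a difference of quadrant vectors. *)
pose a i := tnth (opp_pt v) i / q i.
pose s1 i := Num.max (a i) 0; pose s2 i := Num.max (- a i) 0.
have s10 i : 0 <= s1 i by rewrite le_max lexx orbT.
have s20 i : 0 <= s2 i by rewrite le_max lexx orbT.
have vE f : Tv (u s2) (Tv (opp_pt v) f) = Tv (u s1) f.
  apply: Sfun_eq; apply/funext => x /=; congr (sd_fn f _).
  apply: eq_from_tnth => i; rewrite !tnth_mktuple -addrA; congr (_ + _).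
  have -> : - tnth v i = a i * q i by rewrite /a tnth_mktuple divfK.
  rewrite -mulrDl; congr (_ * _); rewrite /s1 /s2.
  case/orP: (le_total 0 (a i)) => a0.
    by rewrite max_r ?oppr_le0// max_l// add0r.
  by rewrite max_l ?oppr_ge0// max_r// addNr.
pose N := Tv (opp_pt v) @^-1` ((Tv (u s2) @^-1` A `\` A)) `|` (Tv (u s1) @^-1` A `\` A).
have mD s : measurable (Tv (u s) @^-1` A `\` A).
  by apply: measurableD => //; exact: preimage_measurable.
have img : Tv v @` A = Tv (opp_pt v) @^-1` A.
  apply/seteqP; split => [_ [f Af <-]|f Af]; first by rewrite /= TvK.
  by exists (Tv (opp_pt v) f) => //; rewrite TvNK.
exists N; split.
- by apply: measurableU => //; exact: preimage_measurable.
- apply/eqP; rewrite eq_le measure_ge0 andbT.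
  apply: le_trans (measureU2 _ _ _) _ => //; first exact: preimage_measurable.
  have -> : (0 = mu (Tv (u s2) @^-1` A `\` A) + mu (Tv (u s1) @^-1` A `\` A) :> \bar R)%E.
    by rewrite !null// adde0.
  by rewrite leeD// le_eqVlt; apply/orP; left; apply/eqP; exact: inv.
- rewrite img => f [[/= Avf nAf]|[Af nAvf]].
    right; split => //=; rewrite -vE; exact: As.
  by left; split => //=; rewrite vE; exact: As.
Qed.

(** For [a > e] the sublevel set [A a] is null or full. If it were null, the upper limit would be at
    least [a] almost surely, against the bound [e] on its integral. Letting [a] decrease to [e]
    along a sequence gives the claim. *)
Lemma limn_esup_box_le_ae :
  mu [set f | (limn_esup (fun n => (n%:R^-1 ^+ d *
     ip (h f) (box (fun i => n%:R * q i)))%:E) <= e%:E)%E] = 1%E.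
Proof.
have YE f : limn_esup (fun n => (n%:R^-1 ^+ d *
     ip (h f) (box (fun i => n%:R * q i)))%:E) = Y f.
  by congr limn_esup; apply/funext => n; rewrite XdE.
under eq_set do rewrite YE.
pose A a := [set f | (Y f <= a%:E)%E].
have mA a : measurable (A a).
  by rewrite /A -[X in measurable X]setTI; exact: emeasurable_fun_infty_c.
have e0 : 0 <= e.
  by rewrite -lee_fin -eE; apply: integral_ge0 => f _; rewrite lee_fin -(X0 0); case/andP: (XK 0 f (leq0n d)).
have A01 a : e < a -> mu (A a) = 1%E.
  move=> ea; have [s s0 f Af|A0|//] := @quadrant_ergodic (A a) (mA a).
    (* One integer must dominate every coordinate of [s]; a bound of their sum does. *)
    pose m := Num.bound (\sum_i s i).
    have sm i : 0 <= s i <= m%:R.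
      rewrite s0/= (@le_trans _ _ (\sum_i s i))//.
        by rewrite (bigD1 i)//= lerDl sumr_ge0.
      by rewrite ltW// archi_boundP// sumr_ge0.
    exact: le_trans (Y_shift f sm) Af.
  have a0 : 0 <= a := le_trans e0 (ltW ea).
  exfalso; move: ea; apply/negP; rewrite -leNgt -lee_fin -eE.
  apply: le_trans (integral_limsup (leqnn d)).
  apply: (@le_trans _ _ (\int[mu]_f (a%:E * (\1_(~` A a) f)%:E))%E).
    have muC : mu (~` A a) = 1%E by rewrite probability_setC// A0 sube0.
    rewrite le_eqVlt; apply/orP; left; apply/eqP; apply/esym.
    transitivity (a%:E * mu (~` A a))%E; last by rewrite muC mule1.
    rewrite ge0_integralZl//; last first.
      by apply/measurable_EFinP; apply: measurable_indic; exact: measurableC.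
    by rewrite integral_indic ?setIT//; exact: measurableC.
  apply: ge0_le_integral => //.
  - by move=> f _; rewrite mule_ge0.
  - apply: measurable_funeM; apply/measurable_EFinP; apply: measurable_indic.
    exact: measurableC.
  - move=> f _; rewrite indicE; case: (boolP (f \in _)) => fA.
      rewrite mule1; move: fA; rewrite inE /A/= => /negP; rewrite -ltNge.
      exact: ltW.
    by rewrite mule0; case/andP: (YK f).
rewrite (_ : [set f | _] = A e)//.
apply/probability1_ae => //.
have : {ae mu, forall f, forall k, A (e + k.+1%:R^-1) f}.
  apply/ae_foralln => k; apply/probability1_ae => //.
  by apply: A01; rewrite ltrDl invr_gt0.
apply: filterS => f Af; rewrite /A/=; apply/lee_addgt0Pr => eps eps0.
have [k ke] : exists k, k.+1%:R^-1 < eps.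
  exists (Num.bound eps^-1); rewrite invf_plt ?posrE//.
  apply: (@lt_le_trans _ _ (Num.bound eps^-1)%:R); last by rewrite ler_nat.
  by apply: archi_boundP; rewrite invr_ge0 ltW.
by apply: (le_trans (Af k)); rewrite -EFinD lee_fin lerD2l ltW.
Qed.

End box_averages.

(** * The mean of the integral over a box *)

Section complement.
Context {R : realType} {d : nat}.
Local Notation Sd := (Sd R d).
Local Notation lam := (@leb_tuple R d).
Local Notation L1 g := (lam.-integrable setT (EFin \o (g : d.-tuple R -> R))).

Lemma compl_sfun_meas (f : Sd) : measurable_fun setT (fun x => 1 - f x).
Proof. by apply: measurable_funB; [exact: measurable_cst|exact: sfun_meas]. Qed.

Lemma compl_sfun_01 (f : Sd) x : 0 <= 1 - f x <= 1.
Proof. by have /andP[? ?] := sfun_01 f x; apply/andP; split; lra. Qed.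

Definition compl_sfun (f : Sd) : Sd :=
  Build_Sfun (compl_sfun_meas f) (compl_sfun_01 f).

Lemma compl_sfun_Tv v f : compl_sfun (Tv v f) = Tv v (compl_sfun f).
Proof. exact: Sfun_eq. Qed.

Lemma ip_compl_sfun f g : L1 g -> ip (compl_sfun f) g = \int[lam]_x g x - ip f g.
Proof.
move=> ig; rewrite /ip -RintegralB//; last exact: integrable_sfun_mul.
by apply: eq_Rintegral => x _; rewrite mulrBl mul1r.
Qed.

End complement.

Section unit_cube.
Context {R : realType} {d : nat}.
Local Notation Sd := (Sd R d).
Local Notation lam := (@leb_tuple R d).

Let cube : d.-tuple R -> R := pfun (fun _ => \1_`[0, 1]).

Let cubeE : \1_(@unit_cube R d) = cube.
Proof.
apply/funext => x; rewrite /cube /pfun indicE.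
have in01 i : (tnth x i \in `[0, 1]%classic) = (0 <= tnth x i <= 1).
  by apply/idP/idP; rewrite inE/= in_itv.
case: (boolP (x \in @unit_cube R d)) => [|/negP xc].
  rewrite inE => xc; rewrite big1// => i _.
  by rewrite indicE in01 xc.
have [i xi] : exists i, ~ 0 <= tnth x i <= 1.
  by apply/existsNP => xi; apply: xc; rewrite inE.
by rewrite (bigD1 i)//= indicE in01 (negbTE (introN idP xi)) mul0r.
Qed.

Let integral_side : (\int[lebesgue_measure]_x (\1_`[0%R, 1%R] x)%:E = 1 :> \bar R)%E.
Proof.
rewrite integral_indic//= setIT lebesgue_measure_itv/= lte_fin ltr01.
by rewrite sube0.
Qed.

Let integrable_cube : lam.-integrable setT (EFin \o cube).
Proof.
apply: integrable_pfun => [_|_]; first exact: measurable_indic.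
under eq_integral do rewrite ger0_norm//.
by rewrite integral_side ltry.
Qed.

Let integral_cube : \int[lam]_x cube x = 1.
Proof.
rewrite /Rintegral -ge0_leb_intE.
- by rewrite leb_int_pfun ?big1.
- exact: measurable_int integrable_cube.
- by move=> x; rewrite lee_fin prodr_ge0.
Qed.

(** The closed cube minus the half-open box is nonnegative with integral [1 - 1 = 0], which squeezes
    its pairing with [f] to 0. *)
Lemma cube_intE (f : Sd) : cube_int (sd_fn f) = (ip f (box (fun=> 1)))%:E.
Proof.
have -> : cube_int (sd_fn f) = (ip f cube)%:E.
  have ifc := integrable_sfun_mul f integrable_cube.
  rewrite /ip /Rintegral fineK; last exact: integrable_fin_num.
  rewrite -leb_intE// /cube_int cubeE; congr leb_int.
  by apply/funext => x; rewrite mulrC.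
congr EFin; apply/eqP; rewrite -subr_eq0 -ip_subr//; last exact: integrable_box.
have ibc : lam.-integrable setT (EFin \o (fun x => cube x - box (fun=> 1) x)).
  have := integrableB measurableT integrable_cube (integrable_box (fun=> 1)).
  by apply: eq_integrable.
have bc x : 0 <= cube x - box (fun=> 1) x.
  rewrite subr_ge0; apply: ler_prod => i _; rewrite win_ge0 win_indic ler01.
  rewrite !indicE ler_nat; case: (boolP (tnth x i \in `[0, 1[%classic)) => //.
  by rewrite inE/= in_itv/= => /andP[x0 x1]; rewrite mem_set//= in_itv/= x0 ltW.
have := ip_bounded f ibc bc; rewrite RintegralB//; last exact: integrable_box.
by rewrite integral_cube Rintegral_box big1 ?normr1// subrr -eq_le eq_sym.
Qed.

End unit_cube.

Section means.
Context {R : realType} {d : nat}.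
Local Notation Sd := (Sd R d).
Variables (mu : probability Sd R) (inv : translation_invariant mu).

Definition mean (q : 'I_d -> R) : R := fine (\int[mu]_f (ip (sd_fn f) (box q))%:E)%E.

Let ip0 (f : Sd) q : 0 <= ip f (box q).
Proof. by case/andP: (ip_bounded f (integrable_box q) (box_ge0 q)). Qed.

Let mip q : measurable_fun setT (fun f : Sd => (ip f (box q))%:E).
Proof. by apply/measurable_EFinP; apply: measurable_ip; exact: integrable_box. Qed.

Lemma meanE q : (\int[mu]_f (ip (sd_fn f) (box q))%:E)%E = (mean q)%:E.
Proof.
rewrite fineK// ge0_fin_numE; last by apply: integral_ge0 => f _; rewrite lee_fin.
apply: (@le_lt_trans _ _ (\int[mu]_f (\int[leb_tuple d]_x box q x)%:E)%E).
  apply: ge0_le_integral => //.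
  - by move=> f _; rewrite lee_fin.
  - move=> f _; rewrite lee_fin.
    by case/andP: (ip_bounded f (integrable_box q) (box_ge0 q)).
by rewrite integral_cst//= probability_setT mule1 ltry.
Qed.

Let integral_ip_Tv v q :
  (\int[mu]_f (ip (Tv v f) (box q))%:E = (mean q)%:E)%E.
Proof.
rewrite -meanE; apply: (@ge0_integral_invariant _ _ _ mu _ (measurable_Tv v) (@inv v)
  (fun f => (ip f (box q))%:E)) => //.
by move=> f; rewrite lee_fin.
Qed.

Lemma mean_mulrn l (n : nat) q q' : (forall i, i != l -> q' i = q i) ->
  q' l = n%:R * q l -> mean q' = n%:R * mean q.
Proof.
move=> qq' ql; apply: EFin_inj; rewrite -meanE.
under eq_integral do rewrite (ip_box_sum _ qq' ql) -sumEFin.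
rewrite ge0_integral_sum//.
- rewrite (eq_bigr (fun=> (mean q)%:E)).
    by rewrite sumEFin sumr_const card_ord -[_ *+ n]mulr_natl.
  move=> j _; under eq_integral do rewrite iter_Tv_axis.
  exact: integral_ip_Tv.
- move=> j; apply: (measurableT_comp (mip q)); apply: measurable_iter.
  exact: measurable_Tv.
- by move=> j f _; rewrite lee_fin.
Qed.

Lemma win_opp (r x : R) : 0 <= r -> win (- r) x = win r (x + r).
Proof.
move=> r0; have [r0'|r0'] := ltP 0 r; last first.
  have -> : r = 0 by apply/eqP; rewrite eq_le r0 r0'.
  by rewrite oppr0 addr0.
rewrite -[- r]mul1r win_neg ?oppr_lt0// -[r in RHS]mul1r win_pos// !mul1r.
by rewrite -[in RHS]lerBlDr sub0r gtrDr.
Qed.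

(** A box with negative side [q l] is the translate by that side of the box with positive side, so
    invariance of [mu] equates the means. *)
Lemma mean_norm l q q' : (forall i, i != l -> q' i = q i) ->
  q' l = `|q l| -> mean q' = mean q.
Proof.
move=> qq' ql; have [q0|q0] := leP 0 (q l).
  congr mean; apply/funext => i; have [->|/qq'//] := eqVneq i l.
  by rewrite ql ger0_norm.
apply: EFin_inj; transitivity (\int[mu]_f (ip (Tv (axis l (q l)) f) (box q'))%:E)%E.
  by rewrite integral_ip_Tv.
rewrite -meanE.
apply: eq_integral => f _; rewrite ip_Tv; last exact: integrable_box.
congr (ip _ _)%:E; apply/funext => x; rewrite /= /box /pfun.
apply: eq_bigr => i _; rewrite !tnth_mktuple.
have [->|il] := eqVneq i l; last by rewrite qq'// oppr0 addr0.
by rewrite ql ltr0_norm// -win_opp ?opprK// oppr_ge0 ltW.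
Qed.

Lemma ratr_norm_frac (a : rat) : exists p m : nat,
  (m%:R : R) != 0 /\ p%:R = m%:R * `|ratr a : R|.
Proof.
exists `|numq a|%N, `|denq a|%N; split.
  by rewrite pnatr_eq0 absz_eq0 denq_neq0.
by rewrite !natr_absz /ratr normrM normfV !intr_norm mulrC divfK// normr_eq0 intr_eq0 denq_neq0.
Qed.

(** Let the absolute value of [a] be [p / m]. A side of length [p] is tiled both by [p] unit sides
    and by [m] sides of length [p / m]; comparing the two counts gives the factor. *)
Lemma mean_rat l q (a : rat) q' : (forall i, i != l -> q' i = q i) ->
  q l = 1 -> q' l = ratr a -> mean q' = `|ratr a| * mean q.
Proof.
move=> qq' ql q'l; have [p [m [m0 pm]]] := ratr_norm_frac a.
move: (ratr a : R) q'l pm => r q'l pm.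
pose q1 i := if i == l then `|r| else q i.
pose q2 i := if i == l then p%:R else q i.
have q1E i : i != l -> q1 i = q i by rewrite /q1 => /negbTE ->.
have q2E i : i != l -> q2 i = q i by rewrite /q2 => /negbTE ->.
have q1l : q1 l = `|r| by rewrite /q1 eqxx.
have q2l : q2 l = p%:R by rewrite /q2 eqxx.
have m1 : mean q1 = mean q'.
  by apply: (@mean_norm l) => [i il|]; [rewrite q1E// qq'|rewrite q1l q'l].
have m2 : mean q2 = p%:R * mean q.
  by apply: (@mean_mulrn l) => [i il|]; [rewrite q2E|rewrite q2l ql mulr1].
have m3 : mean q2 = m%:R * mean q1.
  by apply: (@mean_mulrn l) => [i il|]; [rewrite (q2E i il) (q1E i il)|rewrite q2l q1l; exact: pm].
have E : m%:R * mean q' = m%:R * (`|r| * mean q).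
  by rewrite mulrA -pm -m1 -m3; exact: m2.
exact: (mulfI m0 E).
Qed.

Lemma mean_prod (a : 'I_d -> rat) :
  mean (fun i => ratr (a i)) = \prod_i `|ratr (a i)| * mean (fun=> 1).
Proof.
pose q l (i : 'I_d) : R := if (i < l)%N then ratr (a i) else 1.
have step l : (l <= d)%N -> mean (q l) = \prod_(i < d | (i < l)%N) `|ratr (a i) : R| * mean (fun=> 1).
  elim: l => [_|l ih ld]; first by rewrite big_pred0// mul1r.
  have qE i : i != Ordinal ld -> q l.+1 i = q l i.
    move=> il; rewrite /q ltnS leq_eqVlt.
    by rewrite (negbTE (il : i != l :> nat)).
  rewrite (@mean_rat (Ordinal ld) (q l) (a (Ordinal ld)) _ qE).
  - rewrite ih; last exact: ltnW.
    rewrite [in RHS](bigD1 (Ordinal ld))//= mulrA; congr (_ * _ * _).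
    by apply: eq_bigl => i; rewrite [LHS]ltn_neqAle [in RHS]ltnS andbC.
  - by rewrite /q ltnn.
  - by rewrite /q ltnSn.
have -> : (fun i => ratr (a i)) = q d by apply/funext => i; rewrite /q ltn_ord.
rewrite step//; congr (_ * _); apply: eq_bigl => i; exact: ltn_ord.
Qed.

End means.

(** * Almost sure limits of box averages *)

(** This rewrites convergence to a given limit as a sublevel condition on an upper limit, from which
    the measurability of convergence sets follows. *)
Lemma limn_esup_dist_le0 (R : realType) (u : R^nat) (l : R) :
  (limn_esup (fun n => `|u n - l|%:E) <= 0)%E <-> u @ \oo --> l.
Proof.
split=> [ul|/cvgrPdist_le ul].
  apply/cvgrPdist_lt => e e0.
  have ue : (limn_esup (EFin \o (fun n => (`|u n - l|)%R)) < e%:E)%E.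
    by rewrite (le_lt_trans ul)// lte_fin.
  by have := limn_esup_lt ue; apply: filterS => n; rewrite distrC.
apply/lee_addgt0Pr => e e0; rewrite add0e.
apply: (@limn_esup_ub _ (fun n => `|u n - l|)).
by apply: filterS (ul e e0) => n; rewrite distrC.
Qed.

Section box_limits.
Context {R : realType} {d : nat}.
Local Notation Rd := (d.-tuple R).
Local Notation Sd := (Sd R d).
Variables (mu : probability Sd R) (inv : translation_invariant mu) (erg : ergodic mu).

Let c : R := fine (\int[mu]_f cube_int (sd_fn f))%E.

Let cE : c = mean mu (fun=> 1).
Proof. by congr fine; apply: eq_integral => f _; exact: cube_intE. Qed.

Definition box_avg (q : 'I_d -> R) (f : Sd) (n : nat) : R :=
  n%:R^-1 ^+ d * ip f (box (fun i => n%:R * q i)).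

Lemma measurable_box_avg_cvg q l :
  measurable [set f | box_avg q f n @[n --> \oo] --> (l : R)].
Proof.
rewrite (_ : [set f | _] =
    [set f | (limn_esup (fun n => `|box_avg q f n - l|%:E) <= 0%:E)%E]); last first.
  by apply/seteqP; split => f /limn_esup_dist_le0.
rewrite -[X in measurable X]setTI; apply: emeasurable_fun_infty_c => //.
apply: measurable_fun_limn_esup => n; apply/measurable_EFinP.
apply: measurableT_comp => //; apply: measurable_funB; last exact: measurable_cst.
apply: measurable_funM; first exact: measurable_cst.
by apply: measurable_ip; exact: integrable_box.
Qed.

Lemma box_avg_cvg_ae (a : 'I_d -> rat) : (forall i, a i != 0) ->
  {ae mu, forall f, box_avg (fun i => ratr (a i)) f n @[n --> \oo] -->
    c * \prod_i `|ratr (a i) : R|}.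
Proof.
move=> a0; set q : 'I_d -> R := fun i => ratr (a i).
set K := \prod_i _; have q0 i : q i != 0 by rewrite fmorph_eq0.
have meanq : mean mu q = c * K by rewrite (mean_prod inv a) -cE mulrC.
have mcompl g : (leb_tuple d).-integrable setT (EFin \o (g : Rd -> R)) ->
    measurable_fun setT (fun f : Sd => ip (compl_sfun f) g).
  move=> ig; rewrite (_ : (fun f => _) = (fun f => \int[leb_tuple d]_x g x - ip (sd_fn f) g)).
    by apply: measurable_funB; [exact: measurable_cst|exact: measurable_ip].
  by apply/funext => f; exact: ip_compl_sfun.
have compl_avg f n : (0 < n)%N ->
    n%:R^-1 ^+ d * ip (compl_sfun f) (box (fun i => n%:R * q i)) = K - box_avg q f n.
  move=> n0; rewrite ip_compl_sfun; last exact: integrable_box.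
  rewrite mulrBr; congr (_ - _); rewrite Rintegral_box.
  under eq_bigr do rewrite normrM normr_nat.
  rewrite big_split/= prodr_const card_ord mulrA -exprMn mulVf ?expr1n ?mul1r//.
  by rewrite pnatr_eq0 -lt0n.
have mean_compl : (\int[mu]_f (ip (compl_sfun f) (box q))%:E = (K - c * K)%:E)%E.
  rewrite -meanq; under eq_integral do rewrite ip_compl_sfun ?integrable_box// Rintegral_box EFinB.
  rewrite integralB//.
  - by rewrite integral_cst//= probability_setT mule1 meanE.
  - exact: finite_measure_integrable_cst.
  - apply/integrableP; split.
      by apply/measurable_EFinP; apply: measurable_ip; exact: integrable_box.
    under eq_integral do rewrite /= ger0_norm ?(andP (ip_bounded _ (integrable_box q) (box_ge0 q))).1//.
    by rewrite meanE ltry.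
have mY (h : Sd -> Sd) : (forall g, (leb_tuple d).-integrable setT (EFin \o (g : Rd -> R)) ->
    measurable_fun setT (fun f => ip (h f) g)) -> forall e : R,
    measurable [set f | (limn_esup (fun n => (n%:R^-1 ^+ d *
     ip (h f) (box (fun i => n%:R * q i)))%:E) <= e%:E)%E].
  move=> mh e; rewrite -[X in measurable X]setTI; apply: emeasurable_fun_infty_c => //.
  apply: measurable_fun_limn_esup => n; apply/measurable_EFinP.
  by apply: measurable_funM; [exact: measurable_cst|apply: mh; exact: integrable_box].
have /(probability1_ae mu (mY id (@measurable_ip R d) _)) up :=
  @limn_esup_box_le_ae R d mu inv erg q id q0 (fun _ _ => erefl) (@measurable_ip R d).
have /(probability1_ae mu (mY _ mcompl _)) dn :=
  @limn_esup_box_le_ae R d mu inv erg q _ q0 (@compl_sfun_Tv R d) mcompl.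
apply: filterS2 up dn => f.
rewrite meanE mean_compl/= meanq => up dn.
apply/cvgrPdist_lt => e e0.
have upe : (limn_esup (EFin \o box_avg q f) < (c * K + e)%:E)%E.
  by rewrite (le_lt_trans up)// lte_fin ltrDl.
have dne : (limn_esup (EFin \o (fun n => (n%:R^-1 ^+ d *
   ip (compl_sfun f) (box (fun i => n%:R * q i)))%R)) < (K - c * K + e)%:E)%E.
  by rewrite (le_lt_trans dn)// lte_fin ltrDl.
near=> n.
have n0 : (0 < n)%N by near: n; exact: nbhs_infty_gt.
have h1 : box_avg q f n < c * K + e by near: n; exact: limn_esup_lt upe.
have h2 : K - box_avg q f n < K - c * K + e.
  by rewrite -compl_avg//; near: n; exact: limn_esup_lt dne.
by rewrite ltr_norml; apply/andP; split; lra.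
Unshelve. all: by end_near. Qed.

(** The sides form a [{ffun}] because that type is countable, which makes this set a countable
    intersection. *)
Definition regular : set Sd := [set f | forall a : {ffun 'I_d -> rat},
  (forall i, a i != 0) ->
  box_avg (fun i => ratr (a i)) f n @[n --> \oo] --> c * \prod_i `|ratr (a i) : R|].

Lemma measurable_regular : measurable regular.
Proof.
(* A code that decodes to nothing falls back to the zero vector, which merely repeats an existing
   index. *)
pose a n : {ffun 'I_d -> rat} := odflt [ffun=> 0] (unpickle n).
rewrite (_ : regular = \bigcap_n (if [forall i, a n i != 0] then
    [set f | box_avg (fun i => ratr (a n i)) f k @[k --> \oo] -->
      c * \prod_i `|ratr (a n i) : R|] else setT)).
  apply: bigcapT_measurable => n.
  by case: ifP => // _; exact: measurable_box_avg_cvg.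
apply/seteqP; split => f fr.
  by move=> n _; case: ifP => // /forallP an; exact: fr.
move=> b b0; have := fr (pickle b) I; rewrite /a pickleK/=.
by case: ifP => // /forallP[].
Qed.

Lemma regular_ae : mu regular = 1%E.
Proof.
apply/probability1_ae; first exact: measurable_regular.
pose a n : {ffun 'I_d -> rat} := odflt [ffun=> 0] (unpickle n).
have : {ae mu, forall f, forall n, (forall i, a n i != 0) ->
    box_avg (fun i => ratr (a n i)) f k @[k --> \oo] --> c * \prod_i `|ratr (a n i) : R|}.
  apply/ae_foralln => n; have [an|an] := pselect (forall i, a n i != 0).
    by apply: filterS (box_avg_cvg_ae an) => f fc _.
  by apply: aeW.
apply: filterS => f fr b b0.
by have := fr (pickle b); rewrite /a pickleK; exact.
Qed.

End box_limits.

(** * From boxes to integrable functions *)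

Section signed_windows.
Context {R : realType}.

(** The sign orients the segment from 0 to [q], as for an integral from 0 to [q]; differences then
    produce every segment [[a, b[], wherever 0 lies. *)
Definition swin (q x : R) : R := (if 0 <= q then 1 else -1) * win q x.

Lemma swin_sub (a b x : R) : a <= b -> swin b x - swin a x = (a <= x < b)%R%:R.
Proof.
move=> ab; rewrite /swin /win.
have [a0|a0] := leP 0 a.
  rewrite (le_trans a0 ab) !mul1r.
  case: (leP a x) => ax /=; case: (ltP x b) => xb /=;
  case: (leP 0 x) => x0 /=; rewrite ?subr0 ?subrr//; exfalso; lra.
have [b0|b0] := leP 0 b; rewrite !mulN1r ?mul1r opprK.
  case: (leP 0 x) => x0 /=; first by rewrite (le_trans (ltW a0) x0)/= addr0.
  by rewrite add0r andbT (lt_le_trans x0 b0) andbT.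
case: (ltP x b) => xb /=; first by rewrite (lt_trans xb b0) oppr0 add0r.
by rewrite (le_trans ab xb)/= addNr.
Qed.

End signed_windows.

(** * Rational boxes as a pi-system generating the Borel sets *)

Section rational_boxes.
Context {R : realType} {d : nat}.
Local Notation Rd := (d.-tuple R).

Definition rbox (a b : 'I_d -> rat) : set Rd :=
  [set x | forall i, ratr (a i) <= tnth x i < ratr (b i)].

Lemma rboxI a b a' b' : rbox a b `&` rbox a' b' =
  rbox (fun i => Num.max (a i) (a' i)) (fun i => Num.min (b i) (b' i)).
Proof.
have rmax (r s : rat) : ratr (Num.max r s) = Num.max (ratr r) (ratr s) :> R.
  by case: (leP r s) => rs; [rewrite max_r ?ler_rat|rewrite max_l ?ler_rat// ltW].
have rmin (r s : rat) : ratr (Num.min r s) = Num.min (ratr r) (ratr s) :> R.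
  by case: (leP r s) => rs; [rewrite min_l ?ler_rat|rewrite min_r ?ler_rat// ltW].
apply/seteqP; split => x.
  move=> [h1 h2] i; have /andP[p1 p2] := h1 i; have /andP[p3 p4] := h2 i.
  by rewrite rmax rmin ge_max lt_min p1 p2 p3 p4.
move=> h; split=> i; have := h i; rewrite rmax rmin ge_max lt_min.
  by move=> /andP[/andP[-> _] /andP[-> _]].
by move=> /andP[/andP[_ ->] /andP[_ ->]].
Qed.

Lemma measurable_rbox a b : measurable (rbox a b).
Proof.
rewrite (_ : rbox a b = \bigcap_(i in [set: 'I_d]) ((fun x : Rd => tnth x i) @^-1`
   `[ratr (a i), ratr (b i)[)); last first.
  apply/seteqP; split => x h i; first by move=> _; rewrite /= in_itv/=; exact: h.
  by have := h i I; rewrite /= in_itv.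
apply: fin_bigcap_measurable => // i _; rewrite -[X in measurable X]setTI.
by apply: measurable_tnth => //; exact: measurable_itv.
Qed.

Lemma measurable_tuple_rbox :
  @measurable _ Rd = <<s [set B | exists a b, B = rbox a b] >>.
Proof.
set B := [set B | _].
apply/seteqP; split; last first.
  apply: smallest_sub; first exact: sigma_algebra_measurable.
  by move=> _ [a [b ->]]; exact: measurable_rbox.
have mtnth i : measurable_fun [set: g_sigma_algebraType B] (fun x : Rd => tnth x i).
  apply: (measurability _ (RGenOInfty.measurableE R)) => _ [_ [y ->] <-].
  rewrite setTI.
  (* The half-space where coordinate [i] exceeds [y] is exhausted by countably many boxes: [k.1] is
     a rational lower end above [y] for that coordinate, and [k.2] bounds all the other ends. *)
  pose aa (k : rat * nat) j : rat := if j == i then k.1 else - k.2%:R.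
  pose bb (k : rat * nat) (j : 'I_d) : rat := k.2%:R.
  rewrite (_ : _ @^-1` _ = \bigcup_(k in [set k : rat * nat | y < ratr k.1]) rbox (aa k) (bb k)).
    rewrite bigcup_mkcond; apply: countable_bigcupT_measurable => [|k]; first exact: countableP.
    by case: ifP => // _; apply: sub_sigma_algebra; exists (aa k), (bb k).
  apply/seteqP; split => x /=; rewrite in_itv/= andbT.
    move=> yx; have [r] := rat_in_itvoo yx; rewrite in_itv/= => /andP[yr rx].
    pose N := Num.bound (\sum_j `|tnth x j|).
    have xN j : `|tnth x j| < N%:R.
      apply: le_lt_trans (archi_boundP _); last by apply: sumr_ge0.
      by rewrite (bigD1 j)//= lerDl sumr_ge0.
    exists (r, N) => // j; rewrite /aa /bb/= ratr_nat.
    have /ltr_normlP[x1 x2] := xN j.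
    rewrite x2 andbT; case: eqP => [->|_]; first exact: ltW.
    by rewrite raddfN/= ratr_nat lerNl ltW.
  move=> [k /= yk /(_ i)]; rewrite /aa eqxx => /andP[kx _].
  exact: lt_le_trans kx.
apply: smallest_sub; first exact: smallest_sigma_algebra.
rewrite -bigcup_seq; apply: bigcup_sub => i _ A [Y mY <-].
exact: mtnth.
Qed.

End rational_boxes.

(** * Test functions along which the dilations converge *)

Section dilations.
Context {R : realType} {d : nat}.
Local Notation Rd := (d.-tuple R).
Local Notation Sd := (Sd R d).
Local Notation lam := (@leb_tuple R d).
Local Notation L1 g := (lam.-integrable setT (EFin \o (g : Rd -> R))).
Variables (f : Sd) (c : R).

Definition good (g : Rd -> R) :=
  L1 g /\ ip (Zt t f) g @[t --> +oo] --> c * \int[lam]_x g x.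

Lemma ip_box_homo (q : 'I_d -> R) s t : 0 <= s <= t ->
  ip f (box (fun i => s * q i)) <= ip f (box (fun i => t * q i)).
Proof.
move=> st; apply: ler_ip; [exact: integrable_box|exact: integrable_box|move=> x].
by apply: ler_prod => i _; rewrite win_ge0 win_le.
Qed.

Lemma good_box (q : 'I_d -> R) :
  box_avg q f n @[n --> \oo] --> c * \prod_i `|q i| -> good (box q).
Proof.
move=> uL; split; first exact: integrable_box.
rewrite Rintegral_box; set L := c * _ in uL *.
pose u := box_avg q f.
(* For [n <= t < n.+1], comparing the box of size [t] with its integer neighbours costs at most this
   volume ratio, on either side. *)
have r1 : (n.+1%:R / n%:R : R) ^+ d @[n --> \oo] --> (1 : R).
  by under eq_fun do rewrite -addn1; exact: cvg_ratio_exp.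
have up : (n.+1%:R / n%:R : R) ^+ d * u n.+1 @[n --> \oo] --> L.
  rewrite -[L]mul1r; apply: cvgM => //.
  by rewrite (cvg_shiftS u).
have lo : ((n.+1%:R / n%:R : R) ^+ d)^-1 * u n @[n --> \oo] --> L.
  rewrite -[L]mul1r; apply: cvgM => //.
  by rewrite -[X in _ --> X]invr1; apply: cvgV.
apply/cvgrPdist_lt => e e0.
have /cvgrPdist_lt/(_ e e0)[N1 _ h1] := up.
have /cvgrPdist_lt/(_ e e0)[N2 _ h2] := lo.
near=> t.
have t1 : 1 <= t by near: t; exact: nbhs_pinfty_ge.
have t0 : 0 < t by exact: lt_le_trans t1.
pose n := Num.truncn t.
have /andP[nt tn] : n%:R <= t < n.+1%:R by apply: truncn_itv; exact: ltW.
have n0 : (0 < n)%N by rewrite /n truncn_gt0.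
have nR0 : 0 < n%:R :> R by rewrite ltr0n.
have Nn : (N1 <= n)%N /\ (N2 <= n)%N.
  have : (maxn N1 N2)%:R <= t by near: t; exact: nbhs_pinfty_ge.
  by move=> /le_lt_trans/(_ tn); rewrite ltr_nat ltnS geq_max => /andP[].
have {}h1 := h1 n Nn.1; have {}h2 := h2 n Nn.2.
have -> : ip (Zt t f) (box q) = t^-1 ^+ d * ip f (box (fun i => t * q i)) by exact: ip_Zt_box.
have Phi0 s : 0 <= ip f (box (fun i => s * q i)).
  by case/andP: (ip_bounded f (integrable_box (fun i => s * q i)) (box_ge0 (fun i => s * q i))).
have hi : t^-1 ^+ d * ip f (box (fun i => t * q i)) <= (n.+1%:R / n%:R) ^+ d * u n.+1.
  rewrite /u /box_avg mulrA -exprMn mulrAC mulfV ?pnatr_eq0// mul1r.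
  apply: ler_pM => //; first by rewrite exprn_ge0// invr_ge0 ltW.
    by apply: lerXn2r; rewrite ?nnegrE ?invr_ge0 ?lef_pV2 ?posrE// ltW.
  by apply: ip_box_homo; rewrite (ltW t0) ltW.
have hl : ((n.+1%:R / n%:R) ^+ d)^-1 * u n <= t^-1 ^+ d * ip f (box (fun i => t * q i)).
  rewrite /u /box_avg mulrA -exprVn invf_div -exprMn mulrAC mulfV ?gt_eqF// mul1r.
  apply: ler_pM => //.
    by apply: lerXn2r; rewrite ?nnegrE ?invr_ge0 ?lef_pV2 ?posrE ?ltr0n// ltW.
  by apply: ip_box_homo; rewrite ler0n.
move: h1 h2; rewrite !ltr_norml => /andP[? ?] /andP[? ?]; apply/andP; split; lra.
Unshelve. all: by end_near. Qed.

Lemma good_scale r g : good g -> good (fun x => r * g x).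
Proof.
move=> [ig cg]; split; first exact: (integrableZl measurableT r ig).
rewrite RintegralZl// mulrCA.
by under eq_fun do rewrite ip_scaler//; exact: cvgMr.
Qed.

Lemma good_sub g1 g2 : good g1 -> good g2 -> good (fun x => g1 x - g2 x).
Proof.
move=> [i1 c1] [i2 c2]; split; first exact: (integrableB measurableT i1 i2).
rewrite RintegralB// mulrBr.
by under eq_fun do rewrite ip_subr//; exact: cvgB.
Qed.

Lemma good0 : good (fun=> 0).
Proof.
split; first exact: integrable0.
rewrite Rintegral_cst// mul0r mulr0.
under eq_fun do rewrite /ip.
rewrite (_ : (fun t => _) = cst 0); first exact: cvg_cst.
apply/funext => t; under eq_Rintegral do rewrite mulr0.
by rewrite Rintegral_cst// mul0r.
Qed.

Lemma good_add g1 g2 : good g1 -> good g2 -> good (fun x => g1 x + g2 x).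
Proof.
move=> G1 G2; have := good_sub G1 (good_sub good0 G2).
by congr good; apply/funext => x; rewrite sub0r opprK.
Qed.

Lemma good_sum I (s : seq I) (G : I -> Rd -> R) : (forall i, good (G i)) ->
  good (fun x => \sum_(i <- s) G i x).
Proof.
move=> gG; elim: s => [|i s ih].
  by under eq_fun do rewrite big_nil; exact: good0.
by under eq_fun do rewrite big_cons; exact: good_add.
Qed.

(** Every [Zt t f] is bounded by 1, so replacing [g] by [gn n] changes the pairing by at most their
    L^1 distance, uniformly in [t]. *)
Lemma good_closure (gn : nat -> Rd -> R) g : (forall n, good (gn n)) -> L1 g ->
  \int[lam]_x `|g x - gn n x| @[n --> \oo] --> (0 : R) -> good g.
Proof.
move=> Gn ig g0; split=> //.
apply/cvgrPdist_lt => e e0.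
have c1 : 0 < 1 + `|c| by rewrite ltr_pwDl.
(* The replacement is paid twice: once in the pairing, and once with factor [c] in the limit. *)
have e1 : 0 < e / 2 / (1 + `|c|) by rewrite !divr_gt0.
have /cvgrPdist_lt/(_ _ e1)[N _ /(_ N (leqnn N))] := g0.
rewrite sub0r normrN ger0_norm; last by apply: Rintegral_ge0.
rewrite ltr_pdivlMr// => hN.
have [iN cN] := Gn N.
have e2 : 0 < e / 2 by rewrite divr_gt0.
have iB := integrableB measurableT ig iN.
near=> t.
have ht : `|c * \int[lam]_x gn N x - ip (Zt t f) (gn N)| < e / 2.
  by near: t; have /cvgrPdist_lt := cN; exact.
have h1 : `|ip (Zt t f) g - ip (Zt t f) (gn N)| <= \int[lam]_x `|g x - gn N x|.
  by rewrite -ip_subr//; exact: ip_norm.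
have h2 : `|\int[lam]_x g x - \int[lam]_x gn N x| <= \int[lam]_x `|g x - gn N x|.
  by rewrite -RintegralB//; exact: le_normr_Rintegral.
set I := \int[lam]_x g x in h2 *; set J := \int[lam]_x gn N x in h2 ht *.
set D := \int[lam]_x `|_| in hN h1 h2.
rewrite (_ : c * I - _ = c * (I - J) + (c * J - ip (Zt t f) (gn N)) -
  (ip (Zt t f) g - ip (Zt t f) (gn N))); last by ring.
apply: (le_lt_trans (ler_normB _ _)); apply: (le_lt_trans (lerD (ler_normD _ _) (lexx _))).
have h3 : `|c * (I - J)| <= `|c| * D by rewrite normrM ler_wpM2l.
lra.
Unshelve. all: by end_near. Qed.

End dilations.

Lemma near_cst_cvg (R : realType) (u : R^nat) (l : R) :
  (\forall n \near \oo, u n = l) -> u @ \oo --> l.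
Proof.
move=> ul; apply: (@cvg_trans _ (cst l @ \oo)); last exact: cvg_cst.
by apply: near_eq_cvg; apply: filterS ul => n ->.
Qed.

(** * From rational boxes to all integrable functions *)

Section density.
Import HBSimple.
Context {R : realType} {d : nat}.
Local Notation Rd := (d.-tuple R).
Local Notation Sd := (Sd R d).
Local Notation lam := (@leb_tuple R d).
Local Notation L1 g := (lam.-integrable setT (EFin \o (g : Rd -> R))).
Variables (f : Sd) (c : R).
Hypothesis f_boxes : forall a : {ffun 'I_d -> rat}, (forall i, a i != 0) ->
  box_avg (fun i => ratr (a i)) f n @[n --> \oo] --> c * \prod_i `|ratr (a i) : R|.
Local Notation good := (@good R d f c).

Let good_swin (a : 'I_d -> rat) : good (pfun (fun i => swin (ratr (a i)))).
Proof.
have [a0|/existsNP[i /negP]] := pselect (forall i, a i != 0); last first.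
  rewrite negbK => /eqP ai.
  rewrite (_ : pfun _ = fun=> 0); first exact: good0.
  apply/funext => x; rewrite /pfun (bigD1 i)//= /swin ai raddf0 /win lexx.
  by case: (leP 0 (tnth x i)) => x0; rewrite ?mulr0 ?mul0r// ltNge x0 mulr0 mul0r.
have G : good (box (fun i => ratr (a i))).
  have [b ab] : exists b : {ffun 'I_d -> rat}, a = b.
    by exists (finfun a); apply/funext => i; rewrite ffunE.
  by move: a0; rewrite ab => b0; apply: good_box; exact: f_boxes.
have := good_scale (\prod_i (if 0 <= ratr (a i) :> R then 1 else -1)) G.
by congr good; apply/funext => x; rewrite -big_split.
Qed.

Let ico (a b : rat) (x : R) : R := swin (ratr b) x - swin (ratr a) x.

Let good_ico (a b : 'I_d -> rat) : good (pfun (fun i => ico (a i) (b i))).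
Proof.
(* The corner expansion of a box is carried out one coordinate at a time. [e] is universally
   quantified because each step uses the previous one at both ends of the new side. *)
suff H l e : (l <= d)%N ->
    good (pfun (fun i : 'I_d => if (i < l)%N then ico (a i) (b i) else swin (ratr (e i)))).
  have := H d (fun=> 0) (leqnn d); congr good; congr pfun.
  by apply/funext => i; rewrite ltn_ord.
elim: l e => [|l ih] e ld; first by under eq_fun do rewrite /=; exact: good_swin.
pose upd r i := if i == Ordinal ld then r else e i.
have := good_sub (ih (upd (b (Ordinal ld))) (ltnW ld)) (ih (upd (a (Ordinal ld))) (ltnW ld)).
congr good; apply/funext => x.
rewrite /pfun !(bigD1 (Ordinal ld) (P := xpredT))//= ltnn ltnSn /upd eqxx.
rewrite [X in _ - _ * X](_ : _ = \prod_(i < d | i != Ordinal ld)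
  (if (i < l.+1)%N then ico (a i) (b i) else swin (ratr (e i))) (tnth x i)).
  rewrite [X in _ * X - _](_ : _ = \prod_(i < d | i != Ordinal ld)
    (if (i < l.+1)%N then ico (a i) (b i) else swin (ratr (e i))) (tnth x i)).
    by rewrite -mulrBl.
  apply: eq_bigr => i il; rewrite (negbTE il) [in RHS]ltnS [in RHS]leq_eqVlt.
  by rewrite (negbTE (il : i != l :> nat)).
apply: eq_bigr => i il; rewrite (negbTE il) [in RHS]ltnS [in RHS]leq_eqVlt.
by rewrite (negbTE (il : i != l :> nat)).
Qed.

Let good_rbox (a b : 'I_d -> rat) : good (\1_(rbox a b) : Rd -> R).
Proof.
have [ab|/existsNP[i /negP]] := pselect (forall i, a i <= b i); last first.
  rewrite -ltNge => ba; rewrite (_ : rbox a b = set0) ?indic0; first exact: good0.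
  rewrite -subset0 => x /(_ i) /andP[h1 h2].
  by have := le_lt_trans h1 h2; rewrite ltr_rat ltNge ltW.
have := good_ico a b; congr good; apply/funext => x.
rewrite /pfun /ico; under eq_bigr do rewrite swin_sub ?ler_rat//.
rewrite indicE; case: (boolP (x \in _)) => [|/negP xab].
  by rewrite inE => xab; rewrite big1// => i _; rewrite xab.
have [i xi] : exists i, ~ ratr (a i) <= tnth x i < ratr (b i).
  by apply/existsNP => xi; apply: xab; rewrite inE.
by rewrite (bigD1 i)//= (negbTE (introN idP xi)) mul0r.
Qed.

Let good_dominated (gn : nat -> Rd -> R) (g h : Rd -> R) : (forall n, good (gn n)) ->
  measurable_fun setT g -> L1 h ->
  (forall n x, `|gn n x| <= h x) -> (forall x, gn n x @[n --> \oo] --> g x) ->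
  good g.
Proof.
move=> Gn mg ih gh gg.
have [] := @dominated_convergence _ _ _ lam setT measurableT (fun n => EFin \o gn n)
  (EFin \o g) (EFin \o h).
- by move=> n; exact: measurable_int (Gn n).1.
- exact/measurable_EFinP.
- by apply: aeW => x _; apply: cvg_EFin; [exact: nearW|exact: gg].
- exact: ih.
- by apply: aeW => x n _; rewrite /= lee_fin.
move=> ig g0 _; apply: (good_closure Gn ig).
move: g0 => /fine_cvg; apply: cvg_trans; apply: near_eq_cvg; apply: nearW => n.
by rewrite /Rintegral; congr fine; apply: eq_integral => x _; rewrite /= distrC.
Qed.

Let cube (N : nat) : set Rd := rbox (fun=> - N%:R) (fun=> N%:R).

Let mcube N : measurable (cube N). Proof. exact: measurable_rbox. Qed.

Let bounded_in_cube x : \forall N \near \oo, cube N x.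
Proof.
pose M := Num.bound (\sum_j `|tnth x j|).
exists M => // N /= MN j; rewrite raddfN/= ratr_nat.
have /ltr_normlP[x1 x2] : `|tnth x j| < N%:R.
  apply: (@lt_le_trans _ _ M%:R); last by rewrite ler_nat.
  apply: le_lt_trans (archi_boundP _); last by apply: sumr_ge0.
  by rewrite (bigD1 j)//= lerDl sumr_ge0.
by rewrite x2 andbT lerNl ltW.
Qed.

(** The constant 1 is in general not integrable, so complements are taken inside a fixed cube, whose
    indicator also dominates the partial unions in the disjoint case. *)
Let good_in_cube N (A : set Rd) : measurable A -> good (\1_(A `&` cube N) : Rd -> R).
Proof.
rewrite measurable_tuple_rbox.
apply: (@dynkin_induction _ _ _ (fun A => good (\1_(A `&` cube N) : Rd -> R)));
  first exact: measurable_tuple_rbox.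
- by move=> _ _ [a [b ->]] [a' [b' ->]]; rewrite rboxI; eexists; eexists.
- by rewrite setTI; exact: good_rbox.
- by move=> _ [a [b ->]]; rewrite rboxI; exact: good_rbox.
- move=> S mS GS; have := good_sub (good_rbox (fun=> - N%:R) (fun=> N%:R)) GS.
  congr good; apply/funext => x; rewrite !indicE !in_setI in_setC.
  by case: (x \in S); case: (x \in cube N) => /=; rewrite ?subrr ?subr0.
- move=> F mF tF GF.
  pose U n := \bigcup_(k in `I_n) F k.
  have mU n : measurable (U n) by apply: bigcup_measurable => k _; exact: mF.
  apply: (@good_dominated (fun n => \1_(U n `&` cube N)) _ (\1_(cube N))).
  + elim=> [|n ih].
      rewrite (_ : U 0 = set0); first by rewrite set0I indic0; exact: good0.
      by rewrite -subset0 => x [].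
    have := good_add ih (GF n); congr good; apply/funext => x.
    have US : U n.+1 = U n `|` F n by rewrite /U !bigcup_mkord big_ord_recr.
    rewrite !indicE !in_setI US in_setU; case: (x \in cube N); rewrite ?andbF ?addr0// !andbT.
    case: (boolP (x \in F n)) => [|_]; last by rewrite orbF addr0.
    rewrite inE => Fnx; rewrite orbT (_ : x \in U n = false) ?add0r//.
    apply/negbTE/negP; rewrite inE => -[k /= kn Fkx].
    have /trivIsetP/(_ k n I I) := tF; rewrite neq_ltn kn => /(_ isT) kn0.
    by have : (F k `&` F n) x by []; rewrite kn0.
  + by apply: measurable_indic; apply: measurableI => //; exact: bigcupT_measurable.
  + exact: (good_rbox _ _).1.
  + by move=> n x; rewrite ger0_norm// !indicE in_setI; case: (x \in cube N); rewrite ?andbT ?andbF// ler_nat; case: (x \in U n).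
  + move=> x; apply: near_cst_cvg; rewrite /=.
    have [[k _ Fkx]|nFx] := pselect ((\bigcup_k F k) x).
      exists k.+1 => // n /= kn; rewrite !indicE !in_setI; congr (nat_of_bool (_ && _))%:R.
      by rewrite !mem_set//; [exists k|exists k].
    apply: nearW => n; rewrite !indicE !in_setI; congr (nat_of_bool (_ && _))%:R.
    rewrite !memNset// => -[k _ Fkx]; apply: nFx; by exists k.
Qed.

Let good_indic (A : set Rd) : measurable A -> (lam A < +oo)%E -> good (\1_A : Rd -> R).
Proof.
move=> mA Aoo.
apply: (@good_dominated (fun N => \1_(A `&` cube N)) _ (\1_A)).
- by move=> N; exact: good_in_cube.
- exact: measurable_indic.
- apply/integrableP; split; first exact/measurable_EFinP/measurable_indic.
  rewrite (eq_integral (fun x => (\1_A x)%:E)); last by move=> x _; rewrite /= ger0_norm.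
  by rewrite integral_indic// setIT.
- move=> N x; rewrite ger0_norm// !indicE in_setI ler_nat.
  by case: (x \in A) => //=; case: (x \in cube N).
- move=> x; apply: near_cst_cvg; apply: filterS (bounded_in_cube x) => N xN.
  by rewrite !indicE in_setI (mem_set xN) andbT.
Qed.

Lemma good_integrable (g : Rd -> R) : L1 g -> good g.
Proof.
move=> ig; have [g_ [ig_ _ g0]] := approximation_sfun_integrable measurableT ig.
pose gn n : Rd -> R := g_ n.
suff Gn n : good (gn n).
  apply: (good_closure Gn ig).
  move: g0 => /fine_cvg; apply: cvg_trans; apply: near_eq_cvg; exact: nearW.
rewrite (_ : gn n = fun x => \sum_(r <- finmap.enum_fset (fset_set (range (g_ n))))
    (r * \1_(g_ n @^-1` [set r]) x)); last first.
  by apply/funext => x; rewrite /gn fimfunE fsbig_finite.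
apply: good_sum => r.
have mr : measurable (g_ n @^-1` [set r]) by exact: measurable_sfunP.
(* The level set of 0 may have infinite measure but contributes nothing; the other level sets have
   finite measure by Markov's inequality. *)
have [->|r0] := eqVneq r 0.
  by under eq_fun do rewrite mul0r; exact: good0.
apply: good_scale; apply: good_indic => //.
have rn0 : 0 < `|r| by rewrite normr_gt0.
have : (`|r|%:E * lam (g_ n @^-1` [set r]) < +oo)%E.
  have /integrableP[mgn] := ig_ n; apply: le_lt_trans.
  rewrite -[X in (_ * lam X)%E]setIT -integral_indic// -ge0_integralZl//; last first.
    by apply/measurable_EFinP; exact: measurable_indic.
  apply: ge0_le_integral => //.
  - apply: measurable_funeM; apply/measurable_EFinP; exact: measurable_indic.
  - exact: measurableT_comp.
  - move=> x _; rewrite /= -EFinM lee_fin indicE; case: (boolP (x \in _)) => [|_].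
      by rewrite inE /= => ->; rewrite mulr1.
    by rewrite mulr0.
case: (lam _) => [? _|/=|//]; first exact: ltry.
by rewrite gt0_muley ?lte_fin.
Qed.

End density.

(** Weak-* convergence involves uncountably many test functions. Proving that the event equals
    [regular] gives its measurability together with its probability. *)
Theorem theorem2p3 (R : realType) (d : nat) (hd : (0 < d)%N)
  (mu : probability (Sd R d) R) :
  translation_invariant mu -> ergodic mu ->
  let c : R := fine (\int[mu]_h cube_int (sd_fn h))%E in
  let E : set (Sd R d) :=
    [set f | (fun t : R => pairing (sd_fn (Zt t f)) : {ptws L1fun R d -> R})
               @ +oo --> (pairing (fun _ => c) : {ptws L1fun R d -> R})] in
  measurable E /\ mu E = 1%E.
Proof.
move=> inv erg c E.
have pairing_cst (G : L1fun R d) : pairing (fun=> c) G = c * \int[leb_tuple d]_x l1f G x.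
  rewrite (@pairing_ip _ _ _ _ `|c|)//.
  by rewrite /ip RintegralZl//; exact: L1fun_integrable.
have cvgE f : E f <-> forall G : L1fun R d,
    ip (Zt t f) (l1f G) @[t --> +oo] --> c * \int[leb_tuple d]_x l1f G x.
  have ipE G : (fun t => ip (Zt t f) (l1f G)) = (fun t => pairing (sd_fn (Zt t f)) G).
    by apply/funext => t; rewrite pairing_sfun.
  rewrite /E/=; split=> [/ptws_cvgP fE G|fE].
    by rewrite ipE -pairing_cst; exact: fE.
  by apply/ptws_cvgP => G; rewrite pairing_cst -ipE; exact: fE.
have -> : E = regular mu.
  apply/seteqP; split => f.
    (* Testing on the boxes themselves and restricting [t] to the positive integers recovers the box
       averages. *)
    move=> /cvgE fE a a0; set q := fun i => ratr (a i).
    have [G GE] := integrable_L1fun (integrable_box q).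
    have := fE G; rewrite GE Rintegral_box => fq.
    have := cvg_comp _ _ (@cvgr_idn R) fq.
    apply: cvg_trans; apply: near_eq_cvg; near=> n.
    rewrite /comp/= ip_Zt_box// ltr0n; near: n; exact: nbhs_infty_gt.
  move=> fr; apply/cvgE => G.
  exact: (good_integrable fr (L1fun_integrable G)).2.
split; [exact: measurable_regular|exact: regular_ae].
Unshelve. all: by end_near. Qed.
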